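(* Let $\delta,H>0$. The set of non-cyclic torsion-free $\delta$-hyperbolic marked groups $(\Gamma,\Sigma)$ with $\operatorname{Ent}(\Gamma,\Sigma)\le H$ has cardinality, up to isomorphism of marked groups, at most $$N_1(\delta,H):=\sum_{i=0}^{N(\delta,H,1)}2^{(2i)^{4\delta+6}},$$ where $N(\delta,H,D):=\nu\big(3^5e^{72H(D+\delta)}\big)\cdot\Big(1+\frac{20(D+\delta)}{5D+\delta}\big(\nu(3^5e^{73H(D+4\delta)})+2\big)\Big)$.
   Context: A marked group $(\Gamma,\Sigma)$ is a group with a finite symmetric generating set; an isomorphism of marked groups is a group isomorphism mapping generating set onto generating set. The Cayley graph $\mathcal G(\Gamma,\Sigma)$ carries the length metric with edges of length $1$. A metric space is $\delta$-hyperbolic if it is proper, geodesic, and every geodesic triangle is $\delta$-thin (any two points of the triangle identified by the canonical tripod approximation, isometric on each side, are at distance $\le\delta$); a marked group is $\delta$-hyperbolic if its Cayley graph is. $\operatorname{Ent}(\Gamma,\Sigma)=\liminf_{R\to\infty}\frac1R\ln\#\{\gamma\in\Gamma:|\gamma|_\Sigma<R\}$, $|\cdot|_\Sigma$ the word length. The function $\nu$ is the nondecreasing integer-valued universal Breuillard–Green–Tao function: for every $K\ge1$, whenever $A,B$ are finite nonempty subsets of a group $G$ with $\#(A\cdot B)\le K(\#A)^{1/2}(\#B)^{1/2}$, there exist a subgroup $G_0$ and a finite normal $L\trianglelefteq G_0$ with $G_0/L$ nilpotent (with a number of generators bounded in terms of $K$) such that $A$ is covered by $\nu(K)$ left translates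 of $G_0$. *)

(* Defs.v *)
From Stdlib Require Import Reals Lra ZArith List ClassicalEpsilon.
Open Scope R_scope.

Definition is_group {G : Type} (mul : G -> G -> G) (inv : G -> G) (one : G) : Prop :=
  (forall x y z, mul x (mul y z) = mul (mul x y) z) /\
  (forall x, mul one x = x) /\
  (forall x, mul (inv x) x = one).

Definition wprod {G : Type} (mul : G -> G -> G) (one : G) (w : list G) : G :=
  fold_right mul one w.

(* S generates G as a monoid (S is symmetric, so this is generation as a group) *)
Definition generates {G : Type} (mul : G -> G -> G) (one : G) (S : list G) : Prop :=
  forall g, exists w : list G, (forall s, In s w -> In s S) /\ wprod mul one w = g.

Record MarkedGroup := MkMarkedGroup {
  mg_carrier : Type;
  mg_mul : mg_carrier -> mg_carrier -> mg_carrier;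
  mg_inv : mg_carrier -> mg_carrier;
  mg_one : mg_carrier;
  mg_is_group : is_group mg_mul mg_inv mg_one;
  mg_gens : list mg_carrier;
  mg_gens_sym : forall s, In s mg_gens -> In (mg_inv s) mg_gens;
  mg_gens_gen : generates mg_mul mg_one mg_gens
}.

Arguments mg_mul {m} _ _.
Arguments mg_inv {m} _.
Arguments mg_one {m}.

Definition marked_iso (M1 M2 : MarkedGroup) : Prop :=
  exists f : mg_carrier M1 -> mg_carrier M2,
    (forall x y, f (mg_mul x y) = mg_mul (f x) (f y)) /\
    (forall x y, f x = f y -> x = y) /\
    (forall z, exists x, f x = z) /\
    (forall s, In s (mg_gens M1) -> In (f s) (mg_gens M2)) /\
    (forall s', In s' (mg_gens M2) -> exists s, In s (mg_gens M1) /\ f s = s').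

Definition gpow {M : MarkedGroup} (g : mg_carrier M) (n : nat) : mg_carrier M :=
  wprod (@mg_mul M) mg_one (repeat g n).

Definition torsion_free (M : MarkedGroup) : Prop :=
  forall g : mg_carrier M, g <> mg_one ->
    forall n : nat, (0 < n)%nat -> gpow g n <> mg_one.

Definition cyclic (M : MarkedGroup) : Prop :=
  exists g : mg_carrier M, forall h : mg_carrier M,
    exists n : nat, h = gpow g n \/ h = mg_inv (gpow g n).

Definition word_of_len (M : MarkedGroup) (g : mg_carrier M) (n : nat) : Prop :=
  exists w : list (mg_carrier M),
    (forall s, In s w -> In s (mg_gens M)) /\ length w = n /\
    wprod (@mg_mul M) mg_one w = g.

Definition wlen (M : MarkedGroup) (g : mg_carrier M) : nat :=
  epsilon (inhabits 0%nat)
    (fun n => word_of_len M g n /\ forall m, word_of_len M g m -> (n <= m)%nat).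

Definition dw (M : MarkedGroup) (g h : mg_carrier M) : R :=
  INR (wlen M (mg_mul (mg_inv g) h)).

(* Ent(Gamma,Sigma) <= H, where Ent is the liminf_{R->oo} (1/R) ln #B(R),
   B(R) = {g : |g| < R}; "#B(R) <= x" is expressed by a covering list. *)
Definition Ent_le (M : MarkedGroup) (H : R) : Prop :=
  forall eps : R, 0 < eps -> forall R0 : R, exists Rr : R,
    R0 <= Rr /\ 0 < Rr /\
    exists l : list (mg_carrier M),
      (forall g, INR (wlen M g) < Rr -> In g l) /\
      ln (INR (length l)) / Rr <= H + eps.

Definition is_geodesic_seg {X : Type} (d : X -> X -> R) (x y : X) (g : R -> X) : Prop :=
  d (g 0) x = 0 /\ d (g (d x y)) y = 0 /\
  forall s t, 0 <= s <= d x y -> 0 <= t <= d x y -> d (g s) (g t) = Rabs (s - t).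

Definition geodesic_space {X : Type} (d : X -> X -> R) : Prop :=
  forall x y : X, exists g, is_geodesic_seg d x y g.

Definition proper_space {X : Type} (d : X -> X -> R) : Prop :=
  forall (x : X) (r : R) (u : nat -> X), (forall n, d x (u n) <= r) ->
    exists (phi : nat -> nat) (y : X),
      (forall n, (phi n < phi (S n))%nat) /\ d x y <= r /\
      (forall eps, 0 < eps -> exists N, forall n, (N <= n)%nat -> d (u (phi n)) y < eps).

Definition gromov {X : Type} (d : X -> X -> R) (x y z : X) : R :=
  (d x y + d x z - d y z) / 2.

Definition thin_triangles {X : Type} (d : X -> X -> R) (delta : R) : Prop :=
  forall (x y z : X) (gxy gxz gyz : R -> X),
    is_geodesic_seg d x y gxy -> is_geodesic_seg d x z gxz -> is_geodesic_seg d y z gyz ->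
    (forall t, 0 <= t <= gromov d x y z -> d (gxy t) (gxz t) <= delta) /\
    (forall t, 0 <= t <= gromov d y x z -> d (gxy (d x y - t)) (gyz t) <= delta) /\
    (forall t, 0 <= t <= gromov d z x y ->
        d (gxz (d x z - t)) (gyz (d y z - t)) <= delta).

Definition hyperbolic_space {X : Type} (d : X -> X -> R) (delta : R) : Prop :=
  proper_space d /\ geodesic_space d /\ thin_triangles d delta.

(* point at distance t in [0,1] from g along the edge [g, g s], s in Sigma, s <> 1 *)
Record CPt (M : MarkedGroup) := MkCPt {
  cp_base : mg_carrier M;
  cp_gen : mg_carrier M;
  cp_t : R;
  cp_valid : In cp_gen (mg_gens M) /\ cp_gen <> mg_one /\ 0 <= cp_t <= 1
}.
Arguments cp_base {M} _.
Arguments cp_gen {M} _.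
Arguments cp_t {M} _.

Definition cdist (M : MarkedGroup) (p q : CPt M) : R :=
  let a := cp_base p in let b := mg_mul a (cp_gen p) in let t := cp_t p in
  let c := cp_base q in let e := mg_mul c (cp_gen q) in let u := cp_t q in
  let via := Rmin (Rmin (t + dw M a c + u) (t + dw M a e + (1 - u)))
                  (Rmin ((1 - t) + dw M b c + u) ((1 - t) + dw M b e + (1 - u))) in
  if excluded_middle_informative (a = c /\ b = e) then Rmin (Rabs (t - u)) via
  else if excluded_middle_informative (a = e /\ b = c) then Rmin (Rabs (t - (1 - u))) via
  else via.

Definition hyperbolic_marked (M : MarkedGroup) (delta : R) : Prop :=
  hyperbolic_space (cdist M) delta.

Definition subgroupP {G : Type} (mul : G -> G -> G) (inv : G -> G) (one : G)
  (P : G -> Prop) : Prop :=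
  P one /\ (forall x y, P x -> P y -> P (mul x y)) /\ (forall x, P x -> P (inv x)).

Definition gen_sub {G : Type} (mul : G -> G -> G) (inv : G -> G) (one : G)
  (P : G -> Prop) (x : G) : Prop :=
  exists w : list G, (forall y, In y w -> P y \/ P (inv y)) /\ wprod mul one w = x.

Definition commg {G : Type} (mul : G -> G -> G) (inv : G -> G) (x y : G) : G :=
  mul (mul (inv x) (inv y)) (mul x y).

(* lower central series: lcs k = gamma_{k+1}(G0) *)
Fixpoint lcs {G : Type} (mul : G -> G -> G) (inv : G -> G) (one : G)
  (G0 : G -> Prop) (k : nat) : G -> Prop :=
  match k with
  | O => G0
  | S k' => gen_sub mul inv one
      (fun z => exists x y, lcs mul inv one G0 k' x /\ G0 y /\ z = commg mul inv x y)
  end.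

Definition BGT_property (nu : R -> nat) : Prop :=
  forall K : R, 1 <= K -> exists r : nat,
  forall (G : Type) (mul : G -> G -> G) (inv : G -> G) (one : G),
    is_group mul inv one ->
    forall A B : list G, A <> nil -> B <> nil -> NoDup A -> NoDup B ->
    (exists l : list G, (forall a b, In a A -> In b B -> In (mul a b) l) /\
        INR (length l) <= K * sqrt (INR (length A)) * sqrt (INR (length B))) ->
    exists G0 L : G -> Prop,
      subgroupP mul inv one G0 /\ subgroupP mul inv one L /\
      (forall x, L x -> G0 x) /\
      (forall g x, G0 g -> L x -> L (mul (mul (inv g) x) g)) /\
      (exists lL : list G, forall x, L x -> In x lL) /\
      (* G0/L nilpotent *)
      (exists c : nat, forall x, lcs mul inv one G0 c x -> L x) /\
      (* G0/L generated by at most r elements *)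
      (exists gs : list G, (length gs <= r)%nat /\ (forall y, In y gs -> G0 y) /\
         forall x, G0 x -> exists y, gen_sub mul inv one (fun z => In z gs) y /\
                                      L (mul (inv y) x)) /\
      (exists ts : list G, (length ts <= nu K)%nat /\
         forall a, In a A -> exists t, In t ts /\ G0 (mul (inv t) a)).

Definition Nbound (nu : R -> nat) (delta H D : R) : R :=
  INR (nu (3 ^ 5 * exp (72 * H * (D + delta)))) *
  (1 + 20 * (D + delta) / (5 * D + delta) *
       (INR (nu (3 ^ 5 * exp (73 * H * (D + 4 * delta)))) + 2)).

(* (2i)^(4 delta + 6), with 0^a = 0 for a > 0 *)
Definition term_exp (delta : R) (i : nat) : R :=
  match i with O => 0 | S _ => Rpower (2 * INR i) (4 * delta + 6) end.

Definition N1bound (nu : R -> nat) (delta H : R) : R :=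
  sum_f_R0 (fun i => Rpower 2 (term_exp delta i))
           (Z.to_nat (Int_part (Nbound nu delta H 1))).

(* Main.v *)
Require Import Defs.
From Stdlib Require Import Reals.
From Stdlib Require Import Lra Lia Psatz ZArith List Permutation Classical ClassicalEpsilon.
Open Scope R_scope.

(** The entropy bound gives, for weights [exp (- c |g|)] with [c > H] and the four-point
inequality, a doubling estimate [#B(2r) <= K #B(r)] with [K = 3^5 exp (72 H (1 + delta))] at some
radius [r] comparable to [1 + delta]: compare the sum of the weights with its translate by [B(2r)]
and note that a ball seen from far away charges mostly the points that point in one direction,
which lie in a ball of half the radius.  By the Breuillard-Green-Tao property [B(r)] is covered by
[V = nu K] cosets of a nilpotent subgroup [G0] (the finite normal subgroup is trivial, as there is
no torsion).  In a torsion-free hyperbolic group commuting nontrivial elements are commensurable,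
and a nontrivial element commensurable to all its conjugates exists only if the group is
cyclic.  Hence a second pigeonhole, applied to the conjugates by a suitable generator, shows that
[G0] has at most [V] elements in [B(2)], so that [#Sigma <= #B(1) <= V^2], much less than
[2 N(delta,H,1)].  Finally thin geodesics show that the relations of length at most
[2 delta + 4] present the group, so a marked group is determined by the set of trivial words of
that length over an alphabet of [V^2 + 1] letters. *)

(** The entropy controls balls only asymptotically, whereas the covering theorem needs doubling at
    one definite radius. The link is that the weight sums over balls grow at most linearly in the
    radius, so nothing may force them to grow geometrically. Hyperbolicity reaches the group theory
    only through two statements on integers, [four_pt] and [thin_geodesics]; no boundary at infinity
    is used. The facts on centralizers come from counting: the centralizer of a nontrivial element
    has linear growth, so the powers of a nontrivial [w] in it have finite index. A second
    pigeonhole is needed because a covering by cosets of [G0] says nothing about the size of [G0].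
    Noncyclicity provides a generator [a] for which [G0] and its conjugate by [a] would meet
    trivially, and the conjugates of short elements of [G0] still lie in [B(r)], where cosets are
    few. *)

Local Notation "x ** y" := (mg_mul x y) (at level 40, left associativity).
Local Notation inv := mg_inv.
Local Notation one := mg_one.

(** * Lists and real numbers *)

Lemma exp_le_exp a b : a <= b -> exp a <= exp b.
Proof. intros [h|<-]; [left; now apply exp_increasing | right; auto]. Qed.

Lemma nat_floor (x : R) : 0 <= x -> exists n : nat, INR n <= x < INR n + 1.
Proof.
  intros hx; destruct (archimed x) as [h1 h2]; exists (Z.to_nat (up x - 1)).
  assert (h : (0 < up x)%Z) by (apply lt_IZR; lra).
  rewrite INR_IZR_INZ, Z2Nat.id, minus_IZR by lia; lra.
Qed.

(** Bernoulli's inequality bounds [q ^ k] below linearly, and its square is quadratic in [k]. Both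
    growth contradictions below end here. *)
Lemma pow_beats_linear (q A B : R) : 1 < q -> exists k : nat, A * INR k + B < q ^ k.
Proof.
  intros hq; set (x := q - 1).
  destruct (INR_unbounded ((2 * Rabs A + Rabs B) / (x * x) + 1)) as [k hk].
  exists (2 * k)%nat.
  assert (hx : 0 < x) by (unfold x; lra).
  assert (hb : 1 + INR k * x <= q ^ k).
  { replace q with (1 + x) by (unfold x; ring); apply poly; exact hx. }
  assert (hxx : 0 < x * x) by nra.
  assert (hc : 2 * Rabs A + Rabs B < INR k * (x * x)).
  { apply (Rmult_lt_reg_r (/ (x * x))); [now apply Rinv_0_lt_compat|].
    rewrite Rmult_assoc, Rinv_r by lra; unfold Rdiv in hk; lra. }
  assert (hk1 : 1 <= INR k).
  { assert (0 <= (2 * Rabs A + Rabs B) / (x * x)); [|lra].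
    apply Rle_mult_inv_pos; auto; assert (h1 := Rabs_pos A); assert (h2 := Rabs_pos B); lra. }
  rewrite mult_INR; simpl (INR 2).
  replace (2 * k)%nat with (k + k)%nat by lia; rewrite pow_add.
  assert (hA := Rle_abs A); assert (hB := Rle_abs B).
  assert (h1 : (INR k * x) * (INR k * x) <= q ^ k * q ^ k) by (apply Rmult_le_compat; nra).
  assert (h2 : (2 * Rabs A + Rabs B) * INR k < INR k * (x * x) * INR k) by (apply Rmult_lt_compat_r; lra).
  assert (h3 := Rabs_pos B); nra.
Qed.

(** The value is chosen for [doubling], where [36 * (27 / 4) = 3 ^ 5]. The proof raises
    [exp (1 / 8) <= 8 / 7] to the power 14. *)
Lemma exp_seven_quarters : exp (7 / 4) <= 27 / 4.
Proof.
  assert (h : exp (1 / 8) <= 8 / 7).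
  { assert (h1 := exp_ineq1_le (- (1 / 8))); rewrite exp_Ropp in h1.
    assert (hp := exp_pos (1 / 8)).
    apply (Rmult_le_reg_r (/ exp (1 / 8))); [now apply Rinv_0_lt_compat|].
    rewrite Rinv_r by lra; lra. }
  replace (7 / 4) with (INR 14 * (1 / 8)) by (simpl; field).
  assert (he : forall n, exp (INR n * (1 / 8)) = exp (1 / 8) ^ n).
  { induction n; [simpl; now rewrite Rmult_0_l, exp_0|].
    rewrite S_INR, Rmult_plus_distr_r, exp_plus, IHn, Rmult_1_l; simpl; ring. }
  rewrite he; apply Rle_trans with ((8 / 7) ^ 14); [|lra].
  apply pow_incr; split; [left; apply exp_pos | exact h].
Qed.

Lemma nat_max_exists (P : nat -> Prop) (B : nat) : (exists n, P n) -> (forall n, P n -> (n <= B)%nat) ->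
  exists n, P n /\ forall m, P m -> (m <= n)%nat.
Proof.
  intros [n0 h0] hB; apply NNPP; intros hn.
  assert (h : forall k, exists n, P n /\ (k <= n)%nat).
  { induction k as [|k [n [hp hk]]]; [exists n0; split; auto; lia|].
    apply NNPP; intros hk'; apply hn; exists n; split; auto; intros m hm.
    apply Nat.nlt_ge; intros hlt; apply hk'; exists m; split; auto; lia. }
  destruct (h (S B)) as [n [hp hk]]; specialize (hB n hp); lia.
Qed.

Lemma sum_f_R0_ge_last (f : nat -> R) N : (forall i, 0 <= f i) -> f N <= sum_f_R0 f N.
Proof.
  intros h; destruct N as [|N]; simpl; [lra|].
  assert (t := cond_pos_sum f N h); lra.
Qed.

Lemma Rpower_INR (a b : nat) : (1 <= a)%nat -> INR (a ^ b) = Rpower (INR a) (INR b).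
Proof. intros h; rewrite Rpower_pow, pow_INR; auto; apply lt_0_INR; lia. Qed.

Definition eq_dec_cl {A : Type} (x y : A) : {x = y} + {x <> y} :=
  excluded_middle_informative (x = y).

Lemma pigeonhole_fibres {A B : Type} (f : A -> B) (F : nat) (c : list B) :
  forall l : list A, NoDup l -> (forall x, In x l -> In (f x) c) ->
  (forall b l', NoDup l' -> incl l' l -> (forall x, In x l' -> f x = b) -> (length l' <= F)%nat) ->
  (length l <= length c * F)%nat.
Proof.
  induction c as [|b c IH]; intros l nd hc hF.
  - destruct l as [|x l]; [simpl; lia | destruct (hc x (or_introl eq_refl))].
  - set (p := fun x => if eq_dec_cl (f x) b then true else false).
    assert (hl : length l = (length (filter p l) + length (filter (fun x => negb (p x)) l))%nat).
    { symmetry; apply filter_length. }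
    assert (h1 : (length (filter p l) <= F)%nat).
    { apply (hF b); [now apply NoDup_filter | intros x hx; now apply filter_In in hx |].
      intros x hx; apply filter_In in hx; destruct hx as [_ hx]; unfold p in hx.
      destruct (eq_dec_cl (f x) b); congruence. }
    assert (h2 : (length (filter (fun x => negb (p x)) l) <= length c * F)%nat).
    { apply IH; [now apply NoDup_filter | |].
      - intros x hx; apply filter_In in hx; destruct hx as [hx hp]; unfold p in hp.
        destruct (hc x hx) as [h|h]; [|exact h].
        destruct (eq_dec_cl (f x) b); [discriminate | congruence].
      - intros b' l' n' i' h'; apply (hF b'); auto.
        intros x hx; specialize (i' x hx); now apply filter_In in i'. }
    simpl; lia.
Qed.

Lemma NoDup_map_inj {A B : Type} (f : A -> B) (l : list A) :
  (forall x y, In x l -> In y l -> f x = f y -> x = y) -> NoDup l -> NoDup (map f l).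
Proof.
  intros hf; induction 1 as [|x l hx nd IH]; simpl; constructor.
  - intros h; apply in_map_iff in h; destruct h as [y [e hy]].
    apply hx; rewrite (hf x y); simpl; auto.
  - apply IH; intros; apply hf; simpl; auto.
Qed.

Lemma not_NoDup_map_eq {A B : Type} (f : A -> B) (l : list A) :
  NoDup l -> ~ NoDup (map f l) -> exists x y, In x l /\ In y l /\ x <> y /\ f x = f y.
Proof.
  intros nd h; apply NNPP; intros hn; apply h, NoDup_map_inj; auto.
  intros x y hx hy e; apply NNPP; intros n; apply hn; exists x, y; auto.
Qed.

Lemma NoDup_list_product {A B : Type} (l : list A) (m : list B) :
  NoDup l -> NoDup m -> NoDup (list_prod l m).
Proof.
  intros hl hm; induction hl as [|a l ha hl IH]; simpl; [constructor|].
  apply NoDup_app; auto.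
  - apply NoDup_map_inj; auto; intros x y _ _ e; congruence.
  - intros p hp hq; apply in_map_iff in hp; destruct hp as [y [<- _]].
    apply in_prod_iff in hq; tauto.
Qed.

Lemma NoDup_enum {A : Type} (P : A -> Prop) (l : list A) :
  (forall x, P x -> In x l) -> exists l', NoDup l' /\ forall x, In x l' <-> P x.
Proof.
  intros h.
  exists (filter (fun x => if excluded_middle_informative (P x) then true else false)
            (nodup eq_dec_cl l)); split.
  - apply NoDup_filter, NoDup_nodup.
  - intros x; rewrite filter_In, nodup_In.
    destruct (excluded_middle_informative (P x)).
    + split; auto.
    + split; [intros [_ e]; discriminate e | contradiction].
Qed.

(** * Finite sums of real and integer weights *)

Definition lsum {A : Type} (f : A -> R) (l : list A) : R := fold_right (fun x r => f x + r) 0 l.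

Lemma lsum_map {A B : Type} (f : B -> R) (h : A -> B) l :
  lsum f (map h l) = lsum (fun x => f (h x)) l.
Proof. induction l; simpl; congruence. Qed.

Lemma lsum_le {A : Type} (f g : A -> R) l :
  (forall x, In x l -> f x <= g x) -> lsum f l <= lsum g l.
Proof.
  induction l as [|a l IH]; simpl; intros h; [lra|].
  assert (f a <= g a) by auto; assert (lsum f l <= lsum g l) by auto; lra.
Qed.

Lemma lsum_scal {A : Type} (f : A -> R) c l : lsum (fun x => c * f x) l = c * lsum f l.
Proof. induction l as [|a l IH]; simpl; [ring | rewrite IH; ring]. Qed.

Lemma lsum_const {A : Type} c (l : list A) : lsum (fun _ => c) l = INR (length l) * c.
Proof.
  induction l as [|a l IH]; [simpl; ring|].
  cbn [lsum fold_right length]; fold (@lsum A (fun _ => c) l); rewrite IH, S_INR; ring.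
Qed.

Lemma lsum_ext {A : Type} (f g : A -> R) l :
  (forall x, In x l -> f x = g x) -> lsum f l = lsum g l.
Proof. induction l; simpl; intros h; [auto | f_equal; auto]. Qed.

Lemma lsum_plus {A : Type} (f g : A -> R) l : lsum (fun x => f x + g x) l = lsum f l + lsum g l.
Proof. induction l as [|a l IH]; simpl; [ring | rewrite IH; ring]. Qed.

Lemma lsum_swap {A B : Type} (f : A -> B -> R) l m :
  lsum (fun x => lsum (f x) m) l = lsum (fun y => lsum (fun x => f x y) l) m.
Proof.
  induction l as [|a l IH]; simpl.
  - rewrite lsum_const; ring.
  - now rewrite IH, lsum_plus.
Qed.

Lemma lsum_app {A : Type} (f : A -> R) l m : lsum f (l ++ m) = lsum f l + lsum f m.
Proof. induction l as [|a l IH]; simpl; [ring | rewrite IH; ring]. Qed.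

Lemma lsum_nonneg {A : Type} (f : A -> R) l : (forall x, In x l -> 0 <= f x) -> 0 <= lsum f l.
Proof.
  induction l as [|a l IH]; simpl; intros h; [lra|].
  assert (0 <= f a) by auto; assert (0 <= lsum f l) by auto; lra.
Qed.

Lemma lsum_incl {A : Type} (f : A -> R) l :
  NoDup l -> forall m, incl l m -> (forall x, In x m -> 0 <= f x) -> lsum f l <= lsum f m.
Proof.
  induction 1 as [|a l ha nd IH]; intros m hi hp.
  - now apply lsum_nonneg.
  - destruct (in_split a m) as [m1 [m2 e]]; [apply hi; now left|].
    assert (h : lsum f l <= lsum f (m1 ++ m2)).
    { apply IH.
      - intros x hx; assert (hm : In x m) by (apply hi; now right).
        subst m; apply in_app_or in hm; apply in_or_app.
        destruct hm as [hm|[hm|hm]]; auto; subst; contradiction.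
      - intros x hx; apply hp; subst m; apply in_app_or in hx; apply in_or_app; simpl; tauto. }
    subst m; rewrite lsum_app in *; simpl; lra.
Qed.

Lemma lsum_indicator {A : Type} (b : A -> bool) K (l : list A) :
  lsum (fun y => if b y then K else 0) l = INR (length (filter b l)) * K.
Proof.
  induction l as [|a l IH]; [simpl; ring|].
  cbn [lsum fold_right filter]; fold (lsum (fun y => if b y then K else 0) l); rewrite IH.
  destruct (b a); [cbn [length]; rewrite S_INR|]; ring.
Qed.

Definition zsum {A : Type} (f : A -> Z) (l : list A) : Z := fold_right (fun x r => f x + r)%Z 0%Z l.

Lemma zsum_map {A B : Type} (f : B -> Z) (h : A -> B) l : zsum f (map h l) = zsum (fun x => f (h x)) l.
Proof. induction l; simpl; congruence. Qed.

Lemma zsum_plus {A : Type} (f g : A -> Z) l : zsum (fun x => f x + g x)%Z l = (zsum f l + zsum g l)%Z.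
Proof. induction l as [|a l IH]; simpl; [reflexivity | rewrite IH; ring]. Qed.

Lemma zsum_ext {A : Type} (f g : A -> Z) l : (forall x, In x l -> f x = g x) -> zsum f l = zsum g l.
Proof. induction l; simpl; intros h; [auto | f_equal; auto]. Qed.

Lemma zsum_perm {A : Type} (f : A -> Z) l m : Permutation l m -> zsum f l = zsum f m.
Proof.
  induction 1; simpl; [reflexivity | now f_equal | ring | congruence].
Qed.

Lemma zsum_const1 {A : Type} (l : list A) : zsum (fun _ => 1%Z) l = Z.of_nat (length l).
Proof.
  induction l as [|a l IH]; [reflexivity|].
  cbn [zsum fold_right length]; fold (@zsum A (fun _ => 1%Z) l); rewrite IH; lia.
Qed.

Fixpoint lists_of_length {A : Type} (l : list A) (m : nat) : list (list A) :=
  match m with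
  | O => nil :: nil
  | S k => map (fun p => fst p :: snd p) (list_prod l (lists_of_length l k))
  end.

Lemma length_lists_of_length {A : Type} (l : list A) m :
  length (lists_of_length l m) = (length l ^ m)%nat.
Proof. induction m as [|m IH]; simpl; [reflexivity|]; now rewrite length_map, length_prod, IH. Qed.

Lemma In_lists_of_length {A : Type} (l : list A) m w :
  (forall x, In x w -> In x l) -> length w = m -> In w (lists_of_length l m).
Proof.
  revert w; induction m as [|m IH]; intros [|x w] hw hlen; try discriminate; [now left|].
  simpl; apply in_map_iff; exists (x, w); split; auto.
  apply in_prod; [apply hw; now left | apply IH; [intros; apply hw; now right | now injection hlen]].
Qed.

(** * Marked groups *)

Lemma mulA {M : MarkedGroup} (x y z : mg_carrier M) : x ** y ** z = x ** (y ** z).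
Proof. symmetry; apply (mg_is_group M). Qed.
Lemma mul1l {M : MarkedGroup} (x : mg_carrier M) : one ** x = x.
Proof. apply (mg_is_group M). Qed.
Lemma mulVl {M : MarkedGroup} (x : mg_carrier M) : inv x ** x = one.
Proof. apply (mg_is_group M). Qed.
Lemma mulKl {M : MarkedGroup} (x y : mg_carrier M) : inv x ** (x ** y) = y.
Proof. now rewrite <- mulA, mulVl, mul1l. Qed.
Lemma mulIl {M : MarkedGroup} (x y z : mg_carrier M) : x ** y = x ** z -> y = z.
Proof. intros h; rewrite <- (mulKl x y), h; apply mulKl. Qed.
Lemma mul1r {M : MarkedGroup} (x : mg_carrier M) : x ** one = x.
Proof. apply (mulIl (inv x)); now rewrite mulKl, mulVl. Qed.
Lemma mulVr {M : MarkedGroup} (x : mg_carrier M) : x ** inv x = one.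
Proof. apply (mulIl (inv x)); now rewrite mulKl, mul1r. Qed.
Lemma mulVKl {M : MarkedGroup} (x y : mg_carrier M) : x ** (inv x ** y) = y.
Proof. now rewrite <- mulA, mulVr, mul1l. Qed.
Lemma inv_inv {M : MarkedGroup} (x : mg_carrier M) : inv (inv x) = x.
Proof. apply (mulIl (inv x)); now rewrite mulVl, mulVr. Qed.
Lemma inv_mul {M : MarkedGroup} (x y : mg_carrier M) : inv (x ** y) = inv y ** inv x.
Proof. apply (mulIl (x ** y)); rewrite mulVr, mulA, mulVKl, mulVr; auto. Qed.
Lemma inv_one {M : MarkedGroup} : inv one = one :> mg_carrier M.
Proof. now rewrite <- (mul1l (inv one)), mulVr. Qed.
Lemma mulIr {M : MarkedGroup} (x y z : mg_carrier M) : y ** x = z ** x -> y = z.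
Proof.
  intros h; rewrite <- (mul1r y), <- (mul1r z), <- (mulVr x), <- !mulA; now rewrite h.
Qed.

Create HintDb grp.
#[local] Hint Rewrite @mulA @mul1l @mul1r @mulVl @mulVr @mulKl @mulVKl @inv_inv @inv_mul @inv_one : grp.
Ltac grp := autorewrite with grp; auto.

Lemma eq_one_of_inv_mul {M : MarkedGroup} (x y : mg_carrier M) : inv x ** y = one -> x = y.
Proof. intros h; apply (mulIl (inv x)); now rewrite mulVl. Qed.

Lemma wprod_app {M : MarkedGroup} (u v : list (mg_carrier M)) :
  wprod mg_mul mg_one (u ++ v) = wprod mg_mul mg_one u ** wprod mg_mul mg_one v.
Proof.
  unfold wprod; induction u as [|a u IH]; simpl; [now grp | rewrite IH; grp].
Qed.

Lemma gpow_S {M : MarkedGroup} (g : mg_carrier M) n : gpow g (S n) = g ** gpow g n.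
Proof. reflexivity. Qed.

Lemma gpow_add {M : MarkedGroup} (g : mg_carrier M) n m : gpow g (n + m) = gpow g n ** gpow g m.
Proof. unfold gpow; now rewrite repeat_app, wprod_app. Qed.

(** * Integer powers and commuting elements *)

Definition zpow {M : MarkedGroup} (g : mg_carrier M) (z : Z) : mg_carrier M :=
  match z with
  | Z0 => one
  | Zpos p => gpow g (Pos.to_nat p)
  | Zneg p => inv (gpow g (Pos.to_nat p))
  end.

Lemma zpow_of_nat {M : MarkedGroup} (g : mg_carrier M) n : zpow g (Z.of_nat n) = gpow g n.
Proof. destruct n; [reflexivity|]; simpl zpow; now rewrite SuccNat2Pos.id_succ. Qed.

Lemma zpow_opp {M : MarkedGroup} (g : mg_carrier M) z : zpow g (- z) = inv (zpow g z).
Proof. destruct z; simpl; grp. Qed.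

Lemma zpow_succ {M : MarkedGroup} (g : mg_carrier M) z : zpow g (Z.succ z) = zpow g z ** g.
Proof.
  assert (hn : forall n, gpow g (S n) = gpow g n ** g).
  { intros n; replace (S n) with (n + 1)%nat by lia; rewrite gpow_add.
    f_equal; unfold gpow; simpl; grp. }
  destruct (Z_le_gt_dec 0 z) as [h|h].
  - rewrite <- (Z2Nat.id z h), <- Nat2Z.inj_succ, !zpow_of_nat; apply hn.
  - set (n := Z.to_nat (- z - 1)).
    replace z with (- Z.of_nat (S n))%Z by lia.
    replace (Z.succ (- Z.of_nat (S n))) with (- Z.of_nat n)%Z by lia.
    rewrite !zpow_opp, !zpow_of_nat, gpow_S; grp.
Qed.

Lemma zpow_add {M : MarkedGroup} (g : mg_carrier M) a b : zpow g (a + b) = zpow g a ** zpow g b.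
Proof.
  revert b; apply Z.peano_ind.
  - rewrite Z.add_0_r; simpl; grp.
  - intros b IH; rewrite Z.add_succ_r, !zpow_succ, IH; grp.
  - intros b IH; apply (mulIr g).
    rewrite <- zpow_succ, mulA, <- zpow_succ.
    replace (Z.succ (a + Z.pred b)) with (a + b)%Z by lia.
    now rewrite Z.succ_pred.
Qed.

Lemma zpow_1 {M : MarkedGroup} (g : mg_carrier M) : zpow g 1 = g.
Proof. change 1%Z with (Z.succ 0); rewrite zpow_succ; simpl; grp. Qed.

Lemma zpow_mul {M : MarkedGroup} (g : mg_carrier M) a b : zpow g (a * b) = zpow (zpow g a) b.
Proof.
  revert b; apply Z.peano_ind.
  - rewrite Z.mul_0_r; reflexivity.
  - intros b IH; rewrite Z.mul_succ_r, zpow_succ, zpow_add, IH; auto.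
  - intros b IH; apply (mulIr (zpow g a)).
    rewrite <- zpow_succ, <- zpow_add, Z.succ_pred, <- IH; f_equal; lia.
Qed.

Lemma zpow_conj {M : MarkedGroup} (a g : mg_carrier M) z :
  zpow (a ** g ** inv a) z = a ** zpow g z ** inv a.
Proof.
  revert z; apply Z.peano_ind.
  - simpl; grp.
  - intros z IH; rewrite !zpow_succ, IH; grp.
  - intros z IH; apply (mulIr (a ** g ** inv a)).
    rewrite <- zpow_succ, Z.succ_pred, IH.
    rewrite <- (Z.succ_pred z) at 1; rewrite zpow_succ; grp.
Qed.

Definition commute {M : MarkedGroup} (x y : mg_carrier M) : Prop := x ** y = y ** x.

Lemma commute_sym {M : MarkedGroup} (x y : mg_carrier M) : commute x y -> commute y x.
Proof. unfold commute; auto. Qed.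

Lemma commute_inv {M : MarkedGroup} (x y : mg_carrier M) : commute x y -> commute x (inv y).
Proof.
  unfold commute; intros h; apply (mulIr y), (mulIl y); grp.
Qed.

Lemma commute_mul {M : MarkedGroup} (x y z : mg_carrier M) :
  commute x y -> commute x z -> commute x (y ** z).
Proof. unfold commute; intros h1 h2; rewrite <- mulA, h1, !mulA, h2; grp. Qed.

Lemma commute_one {M : MarkedGroup} (x : mg_carrier M) : commute x one.
Proof. unfold commute; grp. Qed.

Lemma commute_zpow {M : MarkedGroup} (x y : mg_carrier M) z : commute x y -> commute x (zpow y z).
Proof.
  intros h; revert z; apply Z.peano_ind; [apply commute_one | |]; intros z IH.
  - rewrite zpow_succ; now apply commute_mul.
  - replace (Z.pred z) with (z + - 1)%Z by lia.
    rewrite zpow_add; apply commute_mul; auto.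
    change (-1)%Z with (- (1))%Z; rewrite zpow_opp, zpow_1; now apply commute_inv.
Qed.

Lemma zpow_eq_one {M : MarkedGroup} (tf : torsion_free M) (g : mg_carrier M) z :
  g <> one -> zpow g z = one -> z = 0%Z.
Proof.
  intros hg h; destruct z as [|p|p]; [reflexivity | |]; exfalso; simpl in h.
  - apply (tf g hg (Pos.to_nat p)); [lia | exact h].
  - apply (tf g hg (Pos.to_nat p)); [lia |].
    rewrite <- (inv_inv (gpow g _)), h; grp.
Qed.

Lemma zpow_inj {M : MarkedGroup} (tf : torsion_free M) (g : mg_carrier M) a b :
  g <> one -> zpow g a = zpow g b -> a = b.
Proof.
  intros hg h; assert (hz : (a - b)%Z = 0%Z); [|lia].
  apply (zpow_eq_one tf g); auto.
  unfold Z.sub; rewrite zpow_add, zpow_opp, h; grp.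
Qed.

Lemma gpow_inj {M : MarkedGroup} (tf : torsion_free M) (g : mg_carrier M) a b :
  g <> one -> gpow g a = gpow g b -> a = b.
Proof.
  intros hg; rewrite <- !zpow_of_nat; intros h; apply Nat2Z.inj, (zpow_inj tf g); auto.
Qed.

Lemma finite_subgroup_trivial {M : MarkedGroup} (tf : torsion_free M) (L : mg_carrier M -> Prop) l :
  subgroupP mg_mul mg_inv mg_one L -> (forall x, L x -> In x l) -> forall x, L x -> x = one.
Proof.
  intros [h1 [h2 _]] hl x hx; apply NNPP; intros hn.
  assert (hp : forall n, L (gpow x n)) by (induction n; [exact h1 | rewrite gpow_S; auto]).
  assert (nd : NoDup (map (gpow x) (seq 0 (S (length l))))).
  { apply NoDup_map_inj; [|apply seq_NoDup].
    intros a b _ _; now apply gpow_inj. }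
  apply (NoDup_incl_length (l' := l)) in nd.
  - rewrite length_map, length_seq in nd; lia.
  - intros y hy; apply in_map_iff in hy; destruct hy as [n [<- _]]; auto.
Qed.

(** * Word length and balls *)

Section WordLength.
Context {M : MarkedGroup}.
Local Notation G := (mg_carrier M).

Lemma wlen_spec (g : G) :
  word_of_len M g (wlen M g) /\ forall m, word_of_len M g m -> (wlen M g <= m)%nat.
Proof.
  unfold wlen; apply epsilon_spec.
  destruct (mg_gens_gen M g) as [w [hw e]].
  assert (h : exists n, word_of_len M g n) by (exists (length w), w; auto).
  destruct h as [n hn]; revert hn; induction n as [n IH] using lt_wf_ind; intros hn.
  destruct (classic (exists m, (m < n)%nat /\ word_of_len M g m)) as [[m [hm hg]]|h].
  - now apply (IH m).
  - exists n; split; auto; intros m hm.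
    destruct (Nat.le_gt_cases n m); auto; exfalso; apply h; eauto.
Qed.

Lemma wlen_le (w : list G) : (forall s, In s w -> In s (mg_gens M)) ->
  (wlen M (wprod mg_mul mg_one w) <= length w)%nat.
Proof. intros h; apply wlen_spec; exists w; auto. Qed.

Lemma wlen_word (g : G) : exists w, (forall s, In s w -> In s (mg_gens M)) /\ length w = wlen M g /\
  wprod mg_mul mg_one w = g.
Proof. apply (wlen_spec g). Qed.

Lemma wlen_one : wlen M one = 0%nat.
Proof. assert (h := wlen_le nil); simpl in h; assert (wlen M one <= 0)%nat by (apply h; tauto); lia. Qed.

Lemma wlen_0 (g : G) : wlen M g = 0%nat -> g = one.
Proof.
  intros h; destruct (wlen_word g) as [w [_ [hl e]]]; rewrite h in hl.
  destruct w; [now subst | discriminate].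
Qed.

Lemma wlen_gen (s : G) : In s (mg_gens M) -> (wlen M s <= 1)%nat.
Proof.
  intros hs; assert (h := wlen_le (s :: nil)); simpl in h; rewrite mul1r in h.
  apply h; intros t [<-|[]]; auto.
Qed.

Lemma wlen_mul (g h : G) : (wlen M (g ** h) <= wlen M g + wlen M h)%nat.
Proof.
  destruct (wlen_word g) as [u [hu [lu eu]]]; destruct (wlen_word h) as [v [hv [lv ev]]].
  rewrite <- lu, <- lv, <- length_app, <- eu, <- ev, <- wprod_app; apply wlen_le.
  intros s hs; apply in_app_or in hs; destruct hs; auto.
Qed.

Lemma wlen_inv_le (g : G) : (wlen M (inv g) <= wlen M g)%nat.
Proof.
  destruct (wlen_word g) as [u [hu [lu eu]]]; rewrite <- lu, <- eu; clear lu eu.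
  induction u as [|a u IH]; simpl.
  - rewrite inv_one, wlen_one; lia.
  - rewrite inv_mul.
    assert (h1 := wlen_mul (inv (wprod mg_mul mg_one u)) (inv a)).
    assert (h2 := wlen_gen (inv a) (mg_gens_sym M a (hu a (or_introl eq_refl)))).
    assert (h3 : (wlen M (inv (wprod mg_mul mg_one u)) <= length u)%nat)
      by (apply IH; intros; apply hu; now right).
    unfold wprod in *; lia.
Qed.

Lemma wlen_inv (g : G) : wlen M (inv g) = wlen M g.
Proof.
  assert (h1 := wlen_inv_le g); assert (h2 := wlen_inv_le (inv g)); rewrite inv_inv in h2; lia.
Qed.

Lemma wlen_gpow (g : G) n : (wlen M (gpow g n) <= n * wlen M g)%nat.
Proof.
  induction n; [simpl; unfold gpow; simpl; now rewrite wlen_one|].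
  rewrite gpow_S; assert (h := wlen_mul g (gpow g n)); lia.
Qed.

Definition dn (g h : G) : nat := wlen M (inv g ** h).

Lemma dn_sym g h : dn g h = dn h g.
Proof. unfold dn; rewrite <- wlen_inv; f_equal; grp. Qed.

Lemma dn_tri g h k : (dn g k <= dn g h + dn h k)%nat.
Proof.
  unfold dn; assert (e := wlen_mul (inv g ** h) (inv h ** k)).
  replace (inv g ** h ** (inv h ** k)) with (inv g ** k) in e by grp; exact e.
Qed.

Lemma dn_mul_l a g h : dn (a ** g) (a ** h) = dn g h.
Proof. unfold dn; f_equal; grp. Qed.

Lemma dn_1 g : dn one g = wlen M g.
Proof. unfold dn; f_equal; grp. Qed.

Lemma dn_refl g : dn g g = 0%nat.
Proof. unfold dn; rewrite mulVl; apply wlen_one. Qed.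

Lemma dn_0 g h : dn g h = 0%nat -> g = h.
Proof. intros e; apply wlen_0 in e; now apply eq_one_of_inv_mul. Qed.

Lemma dw_dn g h : dw M g h = INR (dn g h).
Proof. reflexivity. Qed.

Lemma ball_exists (n : nat) : exists l : list G, NoDup l /\ forall g, In g l <-> (wlen M g <= n)%nat.
Proof.
  assert (h : exists l : list G, forall g, (wlen M g <= n)%nat -> In g l).
  { induction n as [|n [l hl]].
    - exists (one :: nil); intros g hg; left; symmetry; apply wlen_0; lia.
    - exists (one :: flat_map (fun s => map (fun g => s ** g) l) (mg_gens M)); intros g hg.
      destruct (wlen_word g) as [[|s w] [hw [lw e]]]; [left; auto | right].
      apply in_flat_map; exists s; split; [apply hw; now left|].
      simpl in e, lw; rewrite <- e; apply in_map, hl.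
      assert (h : (wlen M (wprod mg_mul one w) <= length w)%nat)
        by (apply wlen_le; intros; apply hw; now right).
      lia. }
  destruct h as [l hl]; now apply (NoDup_enum (fun g => (wlen M g <= n)%nat) l).
Qed.

Definition ball (n : nat) : list G := proj1_sig (constructive_indefinite_description _ (ball_exists n)).

Lemma NoDup_ball n : NoDup (ball n).
Proof. unfold ball; destruct constructive_indefinite_description as [l [h1 h2]]; exact h1. Qed.

Lemma In_ball n g : In g (ball n) <-> (wlen M g <= n)%nat.
Proof. unfold ball; destruct constructive_indefinite_description as [l [h1 h2]]; apply h2. Qed.

Definition bsize (n : nat) : nat := length (ball n).

Lemma bsize_ge l n : NoDup l -> (forall g, In g l -> (wlen M g <= n)%nat) -> (length l <= bsize n)%nat.
Proof. intros nd h; apply NoDup_incl_length; auto; intros g hg; now apply In_ball, h. Qed.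

Lemma bsize_mono a b : (a <= b)%nat -> (bsize a <= bsize b)%nat.
Proof. intros h; apply bsize_ge; [apply NoDup_ball|]; intros g hg; apply In_ball in hg; lia. Qed.

Lemma bsize_pos n : (1 <= bsize n)%nat.
Proof.
  assert (h : In one (ball n)) by (apply In_ball; rewrite wlen_one; lia).
  unfold bsize; destruct (ball n); [destruct h | simpl; lia].
Qed.

Lemma wlen_split (g : G) a b : (wlen M g <= a + b)%nat ->
  exists x y, g = x ** y /\ (wlen M x <= a)%nat /\ (wlen M y <= b)%nat.
Proof.
  intros h; destruct (wlen_word g) as [w [hw [hl e]]].
  exists (wprod mg_mul mg_one (firstn a w)), (wprod mg_mul mg_one (skipn a w)); split; [|split].
  - now rewrite <- wprod_app, firstn_skipn.
  - eapply Nat.le_trans; [apply wlen_le|].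
    + intros s hs; apply hw; rewrite <- (firstn_skipn a w); apply in_or_app; auto.
    + rewrite length_firstn; lia.
  - eapply Nat.le_trans; [apply wlen_le|].
    + intros s hs; apply hw; rewrite <- (firstn_skipn a w); apply in_or_app; auto.
    + rewrite length_skipn; lia.
Qed.

Lemma bsize_add a b : (bsize (a + b) <= bsize a * bsize b)%nat.
Proof.
  unfold bsize; rewrite <- length_prod, <- (length_map (fun p => fst p ** snd p) (list_prod _ _)).
  apply NoDup_incl_length; [apply NoDup_ball|].
  intros g hg; apply In_ball, wlen_split in hg; destruct hg as [x [y [-> [hx hy]]]].
  apply in_map_iff; exists (x, y); split; auto.
  apply in_prod; now apply In_ball.
Qed.

End WordLength.

(** * The Cayley graph *)

Section CayleyGraph.
Context {M : MarkedGroup}.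
Local Notation G := (mg_carrier M).

Lemma dw_tri (x y z : G) : dw M x z <= dw M x y + dw M y z.
Proof. rewrite !dw_dn, <- plus_INR; apply le_INR, dn_tri. Qed.

Lemma dw_sym (x y : G) : dw M x y = dw M y x.
Proof. now rewrite !dw_dn, dn_sym. Qed.

Lemma dw_pos (x y : G) : 0 <= dw M x y.
Proof. rewrite dw_dn; apply pos_INR. Qed.

Lemma dw_refl (x : G) : dw M x x = 0.
Proof. now rewrite dw_dn, dn_refl. Qed.

Lemma dw_gen (x s : G) : In s (mg_gens M) -> dw M x (x ** s) <= 1.
Proof.
  intros hs; rewrite dw_dn; replace 1 with (INR 1) by reflexivity; apply le_INR.
  unfold dn; rewrite mulKl; now apply wlen_gen.
Qed.

(** From a vertex, a shortest route to [q] enters its edge at one of the two ends, so the same-edge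
    case of [cdist] disappears. *)
Definition vdist (x : G) (q : CPt M) : R :=
  Rmin (dw M x (cp_base q) + cp_t q) (dw M x (cp_base q ** cp_gen q) + (1 - cp_t q)).

(** Together with [dw_le_vdist], this Lipschitz property stands in for the triangle inequality of
    [cdist] between arbitrary points. *)
Lemma vdist_le_vdist_plus_cdist (x : G) (p q : CPt M) :
  vdist x q <= vdist x p + cdist M p q /\ vdist x p <= vdist x q + cdist M p q.
Proof.
  destruct p as [a s t [hs [ns ht]]]; destruct q as [c r u [hr [nr hu]]].
  unfold vdist, cdist; simpl.
  set (b := a ** s); set (e := c ** r).
  assert (hab : dw M a b <= 1) by now apply dw_gen.
  assert (hce : dw M c e <= 1) by now apply dw_gen.
  assert (x1 := dw_tri x a c); assert (x2 := dw_tri x a e).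
  assert (x3 := dw_tri x b c); assert (x4 := dw_tri x b e).
  assert (y1 := dw_tri x c a); assert (y2 := dw_tri x c b).
  assert (y3 := dw_tri x e a); assert (y4 := dw_tri x e b).
  rewrite (dw_sym c a) in y1; rewrite (dw_sym c b) in y2.
  rewrite (dw_sym e a) in y3; rewrite (dw_sym e b) in y4.
  assert (z1 := dw_tri x a b); assert (z2 := dw_tri x b a); rewrite (dw_sym b a) in z2.
  assert (z3 := dw_tri x c e); assert (z4 := dw_tri x e c); rewrite (dw_sym e c) in z4.
  set (via := Rmin (Rmin (t + dw M a c + u) (t + dw M a e + (1 - u)))
                (Rmin (1 - t + dw M b c + u) (1 - t + dw M b e + (1 - u)))).
  assert (hv : Rmin (dw M x c + u) (dw M x e + (1 - u)) <=
                 Rmin (dw M x a + t) (dw M x b + (1 - t)) + via /\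
               Rmin (dw M x a + t) (dw M x b + (1 - t)) <=
                 Rmin (dw M x c + u) (dw M x e + (1 - u)) + via).
  { unfold via, Rmin; clear via; repeat destruct Rle_dec; lra. }
  destruct (excluded_middle_informative (a = c /\ b = e)) as [[e1 e2]|_].
  - rewrite <- e1, <- e2 in *; revert hv; generalize via; clear; intros via.
    unfold Rmin, Rabs; repeat destruct Rle_dec; destruct Rcase_abs; lra.
  - destruct (excluded_middle_informative (a = e /\ b = c)) as [[e1 e2]|_]; [|exact hv].
    rewrite <- e1, <- e2 in *; revert hv; generalize via; clear; intros via.
    unfold Rmin, Rabs; repeat destruct Rle_dec; destruct Rcase_abs; lra.
Qed.

Lemma dw_le_vdist (x y : G) (q : CPt M) : dw M x y <= vdist x q + vdist y q.
Proof.
  destruct q as [c r u [hr [nr hu]]]; unfold vdist; simpl.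
  set (e := c ** r).
  assert (x1 := dw_tri x c y); assert (x2 := dw_tri x e y).
  rewrite (dw_sym c y) in x1; rewrite (dw_sym e y) in x2.
  assert (z3 := dw_tri x c e); assert (z4 := dw_tri y c e).
  assert (hce : dw M c e <= 1) by now apply dw_gen.
  assert (z5 := dw_tri x e c); assert (z6 := dw_tri y e c).
  rewrite (dw_sym e c) in *.
  unfold Rmin; repeat destruct Rle_dec; lra.
Qed.

Definition vertex_of (q : CPt M) : G :=
  if Rlt_dec (cp_t q) 1 then cp_base q else cp_base q ** cp_gen q.

(** Distances between vertices are integers, so an integral distance forces the parameter of [q] to
    be [0] or [1]. This turns points of real geodesics at integral times into group elements. *)
Lemma vdist_vertex_of (x : G) (n : nat) (q : CPt M) :
  vdist x q = INR n -> forall z, vdist z q = dw M z (vertex_of q).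
Proof.
  destruct q as [c r u [hr [nr hu]]]; unfold vdist, vertex_of; simpl; intros h z.
  set (e := c ** r) in *.
  assert (hce : dw M c e <= 1) by now apply dw_gen.
  assert (z3 := dw_tri z c e); assert (z4 := dw_tri z e c); rewrite (dw_sym e c) in z4.
  assert (hint : u = 0 \/ u = 1).
  { assert (hi : exists k : Z, u = IZR k).
    { rewrite !dw_dn, !INR_IZR_INZ in h; unfold Rmin in h; destruct Rle_dec.
      - exists (Z.of_nat n - Z.of_nat (dn x c))%Z; rewrite minus_IZR; lra.
      - exists (Z.of_nat (dn x e) + 1 - Z.of_nat n)%Z; rewrite minus_IZR, plus_IZR; lra. }
    destruct hi as [k ->]; destruct hu as [h0 h1].
    apply le_IZR in h0; apply le_IZR in h1.
    assert (hk : k = 0%Z \/ k = 1%Z) by lia; destruct hk as [-> | ->]; auto. }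
  destruct Rlt_dec; destruct hint; subst; try lra;
    unfold Rmin; destruct Rle_dec; lra.
Qed.

Context {delta : R} (s0 : G) (hs0 : In s0 (mg_gens M)) (ns0 : s0 <> one)
  (hyp : hyperbolic_marked M delta).

(** Points of the graph are encoded on edges, so a vertex is placed at the start of an edge labelled
    by some nontrivial generator; a non-cyclic group has one. *)
Definition vertex_pt (x : G) : CPt M :=
  MkCPt M x s0 0 (conj hs0 (conj ns0 (conj (Rle_refl 0) Rle_0_1))).

Lemma vdist_vertex_pt (x y : G) : vdist x (vertex_pt y) = dw M x y.
Proof.
  unfold vdist, vertex_pt; simpl.
  assert (h := dw_tri x (y ** s0) y); rewrite (dw_sym (y ** s0) y) in h.
  assert (h1 := dw_gen y s0 hs0).
  unfold Rmin; destruct Rle_dec; lra.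
Qed.

Lemma cdist_vertex_pt (x : G) (q : CPt M) : cdist M (vertex_pt x) q = vdist x q.
Proof.
  apply Rle_antisym.
  - destruct q as [c r u [hr [nr hu]]]; unfold vdist, cdist, vertex_pt; simpl.
    set (b := x ** s0); set (e := c ** r).
    destruct excluded_middle_informative as [[e1 e2]|_];
      [|destruct excluded_middle_informative as [[e1 e2]|_]];
      unfold Rmin; repeat destruct Rle_dec; lra.
  - assert (h := proj1 (vdist_le_vdist_plus_cdist x (vertex_pt x) q)).
    rewrite vdist_vertex_pt, dw_refl in h; lra.
Qed.

(** The Lipschitz property bounds the two distances above by [t] and [dw M x y - t], and by
    [dw_le_vdist] their sum is at least [dw M x y]. The ends of [g] are known only up to distance
    [0], since a vertex has several encodings. *)
Lemma geodesic_vdist (x y : G) (g : R -> CPt M) :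
  is_geodesic_seg (cdist M) (vertex_pt x) (vertex_pt y) g ->
  forall t, 0 <= t <= dw M x y -> vdist x (g t) = t /\ vdist y (g t) = dw M x y - t.
Proof.
  unfold is_geodesic_seg; rewrite cdist_vertex_pt, vdist_vertex_pt.
  intros [h0 [h1 h]] t ht.
  assert (a0 := proj1 (vdist_le_vdist_plus_cdist x (g 0) (g t))).
  assert (a1 := proj2 (vdist_le_vdist_plus_cdist x (g 0) (vertex_pt x))).
  assert (b0 := proj1 (vdist_le_vdist_plus_cdist y (g (dw M x y)) (g t))).
  assert (b1 := proj2 (vdist_le_vdist_plus_cdist y (g (dw M x y)) (vertex_pt y))).
  rewrite vdist_vertex_pt, dw_refl in a1, b1.
  assert (hp := dw_pos x y).
  rewrite h in a0, b0 by lra.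
  assert (hl := dw_le_vdist x y (g t)).
  revert a0 b0; unfold Rabs; repeat destruct Rcase_abs; lra.
Qed.

Lemma geodesic_exists (x y : G) :
  exists g, is_geodesic_seg (cdist M) (vertex_pt x) (vertex_pt y) g.
Proof. apply hyp. Qed.

Lemma geodesics_thin (x y : G) (gx gy : R -> CPt M) :
  is_geodesic_seg (cdist M) (vertex_pt one) (vertex_pt x) gx ->
  is_geodesic_seg (cdist M) (vertex_pt one) (vertex_pt y) gy ->
  forall t, 0 <= t <= (INR (wlen M x) + INR (wlen M y) - INR (dn x y)) / 2 ->
  cdist M (gx t) (gy t) <= delta.
Proof.
  intros hx hy t ht; destruct (geodesic_exists x y) as [gz hz].
  destruct hyp as [_ [_ thin]].
  apply (thin _ _ _ gx gy gz hx hy hz).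
  unfold gromov; rewrite !cdist_vertex_pt, !vdist_vertex_pt, !dw_dn, !dn_1; exact ht.
Qed.

(** Let [t] be the smaller of the Gromov products of [g], [k] and of [k], [h] at [1]. At time [t]
    the geodesic to [k] is within [delta] of those to [g] and to [h], so passing through that point
    bounds [dn g h] by [|g| + |h| - 2 t + 2 delta]. *)
Lemma four_point (g h k : G) :
  INR (dn g h) + INR (wlen M k) <=
  Rmax (INR (wlen M h) + INR (dn g k)) (INR (wlen M g) + INR (dn k h)) + 2 * delta.
Proof.
  destruct (geodesic_exists one g) as [gg hg].
  destruct (geodesic_exists one h) as [gh hh].
  destruct (geodesic_exists one k) as [gk hk].
  set (a := (INR (wlen M g) + INR (wlen M k) - INR (dn g k)) / 2).
  set (b := (INR (wlen M k) + INR (wlen M h) - INR (dn k h)) / 2).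
  assert (x1 := dn_tri k one g); assert (x2 := dn_tri one g k); assert (x3 := dn_tri one k g).
  assert (y1 := dn_tri k one h); assert (y2 := dn_tri one h k); assert (y3 := dn_tri one k h).
  rewrite !dn_1, ?(dn_sym _ one), ?dn_1, ?(dn_sym k g), ?(dn_sym h k) in *.
  apply le_INR in x1, x2, x3, y1, y2, y3; rewrite !plus_INR in *.
  set (t := Rmin a b).
  assert (t0 : 0 <= t) by (unfold t, a, b, Rmin; destruct Rle_dec; lra).
  assert (ta : t <= a) by apply Rmin_l; assert (tb : t <= b) by apply Rmin_r.
  assert (e1 := geodesics_thin g k gg gk hg hk t (conj t0 ta)).
  assert (e2 := geodesics_thin k h gk gh hk hh t (conj t0 tb)).
  assert (d1 := geodesic_vdist one g gg hg t); assert (d2 := geodesic_vdist one h gh hh t).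
  rewrite !dw_dn, !dn_1 in d1, d2.
  destruct d1 as [_ d1]; [unfold a, b in *; lra|].
  destruct d2 as [_ d2]; [unfold a, b in *; lra|].
  assert (l1 := proj1 (vdist_le_vdist_plus_cdist g (gg t) (gk t))).
  assert (l2 := proj2 (vdist_le_vdist_plus_cdist h (gk t) (gh t))).
  assert (l3 := dw_le_vdist g h (gk t)); rewrite dw_dn in l3.
  assert (f : 2 * t = Rmin (2 * a) (2 * b)) by (unfold t, Rmin; repeat destruct Rle_dec; lra).
  revert f; unfold a, b, Rmax, Rmin; repeat destruct Rle_dec; lra.
Qed.

(** Real geodesics sampled at integral times consist of vertices, whose distances are those of the
    graph, so [delta] is unchanged. The condition on [i] says that [i] is at most the Gromov product
    of [g] and [h]. *)
Lemma vertex_geodesics : exists P : G -> nat -> G,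
  (forall g, P g 0%nat = one) /\ (forall g, P g (wlen M g) = g) /\
  (forall g i, (i < wlen M g)%nat -> (dn (P g i) (P g (S i)) <= 1)%nat) /\
  (forall g h i, (2 * i + dn g h <= wlen M g + wlen M h)%nat -> INR (dn (P g i) (P h i)) <= delta).
Proof.
  set (ga := fun g => proj1_sig (constructive_indefinite_description _ (geodesic_exists one g))).
  assert (hga : forall g, is_geodesic_seg (cdist M) (vertex_pt one) (vertex_pt g) (ga g)).
  { intros g; unfold ga; now destruct constructive_indefinite_description. }
  exists (fun g i => vertex_of (ga g (INR i))).
  assert (hv : forall g i, (i <= wlen M g)%nat ->
    (forall z, vdist z (ga g (INR i)) = INR (dn z (vertex_of (ga g (INR i))))) /\
    wlen M (vertex_of (ga g (INR i))) = i /\ dn (vertex_of (ga g (INR i))) g = (wlen M g - i)%nat).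
  { intros g i hi.
    destruct (geodesic_vdist one g (ga g) (hga g) (INR i)) as [h1 h2].
    { rewrite dw_dn, dn_1; split; [apply pos_INR | now apply le_INR]. }
    assert (h3 := vdist_vertex_of one i _ h1).
    rewrite h3, dw_dn, dn_1 in h1; apply INR_eq in h1.
    rewrite h3, !dw_dn, dn_1, <- minus_INR in h2 by assumption; apply INR_eq in h2.
    split; [intros z; now rewrite h3, dw_dn | split; auto].
    now rewrite dn_sym. }
  split; [|split; [|split]].
  - intros g; apply wlen_0, (hv g 0%nat); lia.
  - intros g; apply dn_0; destruct (hv g (wlen M g)) as [_ [_ ->]]; lia.
  - intros g i hi; apply INR_le.
    destruct (hv g i) as [h1 _]; [lia|]; destruct (hv g (S i)) as [h2 _]; [lia|].
    rewrite <- h2.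
    assert (l := proj1 (vdist_le_vdist_plus_cdist (vertex_of (ga g (INR i))) (ga g (INR i)) (ga g (INR (S i))))).
    rewrite h1, dn_refl in l; simpl (INR 0) in l.
    destruct (hga g) as [_ [_ hd]]; rewrite hd in l.
    + replace (INR i - INR (S i)) with (- (1)) in l by (rewrite S_INR; ring).
      rewrite Rabs_Ropp, Rabs_R1 in l; simpl (INR 1); lra.
    + rewrite cdist_vertex_pt, vdist_vertex_pt, dw_dn, dn_1; split; [apply pos_INR | apply le_INR; lia].
    + rewrite cdist_vertex_pt, vdist_vertex_pt, dw_dn, dn_1; split; [apply pos_INR | apply le_INR; lia].
  - intros g h i hi.
    assert (t1 := dn_tri one g h); assert (t2 := dn_tri one h g); rewrite (dn_sym h g), !dn_1 in *.
    destruct (hv g i) as [h1 _]; [lia|]; destruct (hv h i) as [h2 _]; [lia|].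
    rewrite <- h2.
    assert (l := proj1 (vdist_le_vdist_plus_cdist (vertex_of (ga g (INR i))) (ga g (INR i)) (ga h (INR i)))).
    rewrite h1, dn_refl in l; simpl (INR 0) in l.
    assert (c := geodesics_thin g h (ga g) (ga h) (hga g) (hga h) (INR i)).
    assert (hi' : 0 <= INR i <= (INR (wlen M g) + INR (wlen M h) - INR (dn g h)) / 2).
    { split; [apply pos_INR|]; apply le_INR in hi; rewrite !plus_INR, mult_INR in hi.
      simpl (INR 2) in hi; lra. }
    specialize (c hi'); lra.
Qed.

End CayleyGraph.

(** * Doubling *)

(** Word lengths are integers, so the error [2 * delta] can be rounded down to a natural number [e],
    and estimates become linear arithmetic. *)
Definition four_pt (M : MarkedGroup) (e : nat) : Prop := forall g h k : mg_carrier M,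
  (dn g h + wlen M k <= Nat.max (wlen M h + dn g k) (wlen M g + dn k h) + e)%nat.

Lemma geodesic_point {M : MarkedGroup} (g : mg_carrier M) i : (i <= wlen M g)%nat ->
  exists p, wlen M p = i /\ dn p g = (wlen M g - i)%nat.
Proof.
  intros hi; destruct (wlen_split g i (wlen M g - i)) as [x [y [e [hx hy]]]]; [lia|].
  exists x; assert (h := wlen_mul x y); rewrite <- e in h.
  unfold dn; rewrite e, mulKl, <- e; lia.
Qed.

Section Doubling.
Context {M : MarkedGroup} (c : R) (hc : 0 < c).
Local Notation G := (mg_carrier M).

(** The Poincaré series with exponent [c], truncated to a ball. *)
Definition poincare (n : nat) : R := lsum (fun g : G => exp (- c * INR (wlen M g))) (ball n).

Lemma poincare_linear (C : R) : (forall k, INR (@bsize M k) * exp (- c * INR k) <= C) ->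
  forall n, poincare n <= C * (INR n + 1).
Proof.
  intros hC; assert (hb : forall n (l : list G), NoDup l -> (forall g, In g l -> wlen M g = n) ->
    lsum (fun g : G => exp (- c * INR (wlen M g))) l <= C).
  { intros n l nd hl; eapply Rle_trans; [|apply (hC n)].
    rewrite (lsum_ext _ (fun _ => exp (- c * INR n))), lsum_const by (intros x hx; now rewrite hl).
    apply Rmult_le_compat_r; [left; apply exp_pos|].
    apply le_INR, bsize_ge; auto; intros g hg; now rewrite hl. }
  induction n as [|n IH].
  - simpl INR; rewrite Rplus_0_l, Rmult_1_r; apply (hb 0%nat); [apply NoDup_ball|].
    intros g hg; apply In_ball in hg; lia.
  - rewrite S_INR; unfold poincare in *.
    set (sp := filter (fun g => Nat.eqb (wlen M g) (S n)) (@ball M (S n))).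
    eapply Rle_trans; [apply (lsum_incl _ _ (NoDup_ball (S n)) (ball n ++ sp))|].
    + intros g hg; apply in_or_app; destruct (Nat.eq_dec (wlen M g) (S n)) as [e|e].
      * right; apply filter_In; split; [exact hg | now apply Nat.eqb_eq].
      * left; apply In_ball in hg; apply In_ball; lia.
    + intros; left; apply exp_pos.
    + rewrite lsum_app.
      assert (h : lsum (fun g : G => exp (- c * INR (wlen M g))) sp <= C); [|lra].
      apply (hb (S n)); [apply NoDup_filter, NoDup_ball|].
      intros g hg; apply filter_In in hg; now apply Nat.eqb_eq.
Qed.

(** Translation by [y] in [B(Q)] moves [B(n)] inside [B(n + Q)] and changes the weight of [gam] by
    the factor [exp (c * (|gam| - d(y, gam)))]. After exchanging the sums over [y] and [gam], the
    hypothesis applies at each [gam]. *)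
Lemma poincare_step (Q : nat) (B : R) :
  (forall gam : G, lsum (fun y => exp (c * (INR (wlen M gam) - INR (dn y gam)))) (ball Q) <= B) ->
  forall n, INR (@bsize M Q) * poincare n <= B * poincare (n + Q).
Proof.
  intros hB n; unfold bsize; rewrite <- lsum_const; unfold poincare at 2.
  rewrite <- lsum_scal.
  eapply Rle_trans; [|apply (lsum_le (fun gam =>
    lsum (fun y => exp (- c * INR (dn y gam))) (ball Q)))].
  - rewrite lsum_swap; apply lsum_le; intros y hy; unfold poincare.
    rewrite (lsum_ext _ (fun g => exp (- c * INR (dn y (y ** g))))),
      <- (lsum_map (fun g => exp (- c * INR (dn y g))) (fun g => y ** g)).
    + apply lsum_incl; [| | intros; left; apply exp_pos].
      * apply NoDup_map_inj; [|apply NoDup_ball]; intros a b _ _; apply mulIl.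
      * intros g hg; apply in_map_iff in hg; destruct hg as [h [<- hh]].
        apply In_ball in hh, hy; apply In_ball; assert (t := wlen_mul y h); lia.
    + intros g _; unfold dn; now rewrite mulKl.
  - intros gam _; specialize (hB gam).
    eapply Rle_trans; [|apply Rmult_le_compat_r; [left; apply exp_pos | exact hB]].
    rewrite Rmult_comm, <- lsum_scal; right; apply lsum_ext; intros y _.
    rewrite <- exp_plus; f_equal; ring.
Qed.

(** Otherwise each increase of the radius by [Q] would multiply the truncated series by at least
    [q > 1], against its linear growth. *)
Lemma bsize_le_of_shadow_sums (C B : R) (Q : nat) :
  (forall k, INR (@bsize M k) * exp (- c * INR k) <= C) -> 0 < B ->
  (forall gam : G, lsum (fun y => exp (c * (INR (wlen M gam) - INR (dn y gam)))) (ball Q) <= B) ->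
  INR (@bsize M Q) <= B.
Proof.
  intros hC hB h; apply Rnot_lt_le; intros hlt.
  set (q := INR (@bsize M Q) / B).
  assert (hq : 1 < q).
  { unfold q; apply (Rmult_lt_reg_r B); auto; unfold Rdiv.
    rewrite Rmult_assoc, Rinv_l by lra; lra. }
  assert (h0 : 1 <= poincare 0).
  { unfold poincare; eapply Rle_trans; [|apply (lsum_incl _ (one :: nil))].
    - simpl; rewrite wlen_one; simpl; rewrite Rmult_0_r, exp_0; lra.
    - constructor; [simpl; tauto | constructor].
    - intros x [<-|[]]; apply In_ball; now rewrite wlen_one.
    - intros; left; apply exp_pos. }
  assert (hk : forall k, q ^ k <= poincare (k * Q)).
  { induction k as [|k IH]; [simpl; exact h0|].
    assert (hs := poincare_step Q B h (k * Q)).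
    replace (k * Q + Q)%nat with (S k * Q)%nat in hs by lia.
    simpl (q ^ S k); apply Rle_trans with (q * poincare (k * Q)).
    - apply Rmult_le_compat_l; lra.
    - apply (Rmult_le_reg_l B); auto; rewrite <- Rmult_assoc.
      replace (B * q) with (INR (@bsize M Q)) by (unfold q; field; lra); exact hs. }
  destruct (pow_beats_linear q (C * INR Q) C hq) as [k hlin].
  assert (hp := poincare_linear C hC (k * Q)); rewrite mult_INR in hp.
  specialize (hk k); lra.
Qed.

(** Seen from [gam], the points of [B(Q)] in the direction of [gam] weigh at most [exp (c * Q)] each
    and fill at most a ball of radius [Q - m + e]. All others weigh at most
    [exp (- c * (Q - 2 * m))], and their share is moved to the left-hand side. *)
Lemma bishop_gromov_step (C : R) (e Q m : nat) :
  four_pt M e -> (forall k, INR (@bsize M k) * exp (- c * INR k) <= C) -> (2 * m <= Q)%nat ->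
  INR (@bsize M Q) * (1 - exp (- c * INR (Q - 2 * m))) <=
  exp (c * INR Q) * INR (@bsize M (Q - m + e)).
Proof.
  intros h4 hC hm.
  assert (hmain : INR (@bsize M Q) <= INR (@bsize M (Q - m + e)) * exp (c * INR Q) +
                      INR (@bsize M Q) * exp (- c * INR (Q - 2 * m))); [|lra].
  assert (hp1 := exp_pos (c * INR Q)); assert (hp2 := exp_pos (- c * INR (Q - 2 * m))).
  assert (hf1 : 0 < INR (@bsize M Q)) by (apply lt_0_INR; assert (h := @bsize_pos M Q); lia).
  assert (hf2 : 0 <= INR (@bsize M (Q - m + e))) by apply pos_INR.
  apply (bsize_le_of_shadow_sums C); [exact hC | nra |]; intros gam.
  set (near := fun y => Nat.leb (dn y gam + 2 * m) (wlen M gam + Q)).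
  apply Rle_trans with (lsum (fun y => (if near y then exp (c * INR Q) else 0)
                                + exp (- c * INR (Q - 2 * m))) (ball Q)).
  - apply lsum_le; intros y hy; apply In_ball in hy.
    assert (hexp : forall a b : R, a <= b -> exp a <= exp b).
    { intros a b [hab|<-]; [left; now apply exp_increasing | right; auto]. }
    unfold near; destruct (Nat.leb_spec (dn y gam + 2 * m) (wlen M gam + Q)) as [hl|hl].
    + assert (hu : exp (c * (INR (wlen M gam) - INR (dn y gam))) <= exp (c * INR Q)); [|lra].
      apply hexp, Rmult_le_compat_l; [lra|].
      assert (t := dn_tri one y gam); rewrite !dn_1 in t.
      assert (t' : (wlen M gam <= dn y gam + Q)%nat) by lia.
      apply le_INR in t'; rewrite plus_INR in t'; lra.
    + assert (hu : exp (c * (INR (wlen M gam) - INR (dn y gam))) <= exp (- c * INR (Q - 2 * m))); [|lra].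
      apply hexp; replace (- c * INR (Q - 2 * m)) with (c * - INR (Q - 2 * m)) by ring.
      apply Rmult_le_compat_l; [lra|].
      rewrite minus_INR, mult_INR by lia; simpl (INR 2).
      apply lt_INR in hl; rewrite !plus_INR, mult_INR in hl; simpl (INR 2) in hl; lra.
  - rewrite lsum_plus, lsum_indicator, lsum_const.
    apply Rplus_le_compat; [|apply Rle_refl].
    apply Rmult_le_compat_r; [lra|]; apply le_INR.
    (* The centre is the point at distance [m] from [1] on a geodesic to [gam], by the four-point
       inequality for [y], [p], [gam]; when [gam] is closer than [m], it is [gam] itself. *)
    assert (hp : exists p : G, forall y, In y (ball Q) -> near y = true -> (dn p y <= Q - m + e)%nat).
    { destruct (Nat.le_gt_cases m (wlen M gam)) as [hg|hg].
      - destruct (geodesic_point gam m hg) as [p [hp1' hp2']]; exists p; intros y hy hn.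
        apply In_ball in hy; apply Nat.leb_le in hn.
        assert (t := h4 y p gam); rewrite (dn_sym gam p) in t; rewrite (dn_sym p y); lia.
      - exists gam; intros y hy hn; apply Nat.leb_le in hn; rewrite dn_sym; lia. }
    destruct hp as [p hp].
    rewrite <- (length_map (fun y => inv p ** y)); apply bsize_ge.
    + apply NoDup_map_inj; [|apply NoDup_filter, NoDup_ball]; intros a b _ _; apply mulIl.
    + intros g hg; apply in_map_iff in hg; destruct hg as [y [<- hy]].
      apply filter_In in hy; now apply hp.
Qed.

End Doubling.

(** The liminf only yields some large radius [n0] whose ball is small. Submultiplicativity carries
    the bound to the multiples of [n0], and [C] absorbs the remainder. *)
Lemma bsize_growth (M : MarkedGroup) (H c : R) : 0 < H -> H < c -> Ent_le M H ->
  exists C, forall k, INR (@bsize M k) * exp (- c * INR k) <= C.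
Proof.
  intros hH hc hE.
  (* Half of the gap [c - H] is spent on [eps]. Beyond the chosen threshold the other half pays for
     replacing [Rr] by an integer [n0 > Rr - 2]. *)
  destruct (hE ((c - H) / 2) ltac:(lra) (2 * (H + c) / (c - H) + 3)) as [Rr [h1 [h2 [l [h3 h4]]]]].
  (* [Ent_le] counts open balls while [ball] is closed; [up Rr - 2] is strictly below [Rr]. *)
  set (n0 := Z.to_nat (up Rr - 2)).
  destruct (archimed Rr) as [a1 a2].
  assert (hpos : 0 <= 2 * (H + c) / (c - H)) by (apply Rle_mult_inv_pos; lra).
  assert (hup : (0 <= up Rr - 2)%Z).
  { apply le_IZR; rewrite minus_IZR; lra. }
  assert (hn : INR n0 = IZR (up Rr) - 2).
  { unfold n0; rewrite INR_IZR_INZ, Z2Nat.id, minus_IZR by exact hup; ring. }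
  assert (hn1 : 2 * (H + c) / (c - H) + 1 < INR n0) by lra.
  assert (hn0 : (1 <= n0)%nat).
  { apply INR_le; simpl; lra. }
  assert (hl : (@bsize M n0 <= length l)%nat).
  { apply NoDup_incl_length; [apply NoDup_ball|].
    intros g hg; apply In_ball, le_INR in hg; apply h3; lra. }
  assert (hf : INR (@bsize M n0) <= exp (c * INR n0)).
  { assert (hb : 0 < INR (@bsize M n0)) by (apply lt_0_INR; assert (h := @bsize_pos M n0); lia).
    apply Rle_trans with (INR (length l)); [now apply le_INR|].
    assert (hll : 0 < INR (length l)) by (apply le_INR in hl; lra).
    rewrite <- (exp_ln (INR (length l))) by exact hll; apply exp_le_exp.
    assert (h5 : ln (INR (length l)) <= (H + (c - H) / 2) * Rr).
    { apply (Rmult_le_reg_r (/ Rr)); [now apply Rinv_0_lt_compat|].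
      rewrite Rmult_assoc, Rinv_r, Rmult_1_r by lra; exact h4. }
    eapply Rle_trans; [exact h5|].
    assert (h6 : 2 * (H + c) <= INR n0 * (c - H)).
    { apply (Rmult_le_reg_r (/ (c - H))); [apply Rinv_0_lt_compat; lra|].
      rewrite (Rmult_assoc (INR n0)), Rinv_r by lra.
      unfold Rdiv in hn1; lra. }
    nra. }
  assert (hq : forall q, INR (@bsize M (q * n0)) <= exp (c * INR (q * n0))).
  { induction q as [|q IH].
    - simpl (0 * n0)%nat; simpl (INR 0); rewrite Rmult_0_r, exp_0.
      assert (hb0 : (@bsize M 0 <= 1)%nat); [|apply le_INR in hb0; exact hb0].
      apply (NoDup_incl_length (l' := one :: nil) (NoDup_ball 0)).
      intros g hg; apply In_ball in hg; left; symmetry; apply wlen_0; lia.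
    - replace (S q * n0)%nat with (q * n0 + n0)%nat by lia.
      eapply Rle_trans; [apply le_INR, bsize_add|].
      rewrite mult_INR, plus_INR, Rmult_plus_distr_l, exp_plus.
      apply Rmult_le_compat; auto using pos_INR. }
  exists (exp (c * INR n0)); intros k.
  assert (hk := Nat.div_mod_eq k n0); assert (hr := Nat.mod_upper_bound k n0).
  assert (hk' : (k <= (k / n0 + 1) * n0)%nat) by lia.
  assert (hk2 : ((k / n0 + 1) * n0 <= k + n0)%nat) by lia.
  apply (@bsize_mono M) in hk'; apply le_INR in hk', hk2.
  specialize (hq (k / n0 + 1)%nat).
  assert (h7 : INR (@bsize M k) <= exp (c * INR (k + n0))).
  { eapply Rle_trans; [exact hk'|]; eapply Rle_trans; [exact hq|].
    apply exp_le_exp; apply Rmult_le_compat_l; lra. }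
  replace (exp (c * INR n0)) with (exp (c * INR (k + n0)) * exp (- c * INR k)).
  - apply Rmult_le_compat_r; [left; apply exp_pos | exact h7].
  - rewrite <- exp_plus; f_equal; rewrite plus_INR; ring.
Qed.

(** One step cannot halve a radius, as a nontrivial estimate requires [2 * m < Q]. Two steps pass
    through the radii [6], [4] and [3] times [3 * e + 7], which is of order [1 + delta]; both leave
    [Q - 2 * m = 4 * e + 14]. *)
Lemma doubling (M : MarkedGroup) (delta H : R) (e : nat) :
  0 < delta -> 0 < H -> INR e <= 2 * delta < INR e + 1 -> four_pt M e -> Ent_le M H ->
  INR (@bsize M ((9 * e + 21) + (9 * e + 21))) <=
  3 ^ 5 * exp (72 * H * (1 + delta)) * INR (@bsize M (9 * e + 21)).
Proof.
  intros hd hH he h4 hE.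
  (* The total exponent [30 * e + 70] is at most [70 * X], and this [c] makes [c * (70 * X)] equal
     to [70 * H * X + 7 / 4]. It also gives [w >= 1 / 6] in both steps, so the constant is
     [6 * 6 * (27 / 4) = 3 ^ 5]. *)
  set (X := 1 + delta); set (c := H + / (40 * X)).
  assert (hX : 0 < X) by (unfold X; lra).
  assert (hi : 0 < / (40 * X)) by (apply Rinv_0_lt_compat; lra).
  assert (hcX : c * X = H * X + 1 / 40) by (unfold c; field; lra).
  assert (hc : 0 < c) by (unfold c; lra).
  destruct (bsize_growth M H c hH ltac:(unfold c; lra) hE) as [C hC].
  assert (s1 := bishop_gromov_step c hc C e (18 * e + 42) (7 * e + 14) h4 hC ltac:(lia)).
  assert (s2 := bishop_gromov_step c hc C e (12 * e + 28) (4 * e + 7) h4 hC ltac:(lia)).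
  replace (18 * e + 42 - 2 * (7 * e + 14))%nat with (4 * e + 14)%nat in s1 by lia.
  replace (12 * e + 28 - 2 * (4 * e + 7))%nat with (4 * e + 14)%nat in s2 by lia.
  replace (18 * e + 42 - (7 * e + 14) + e)%nat with (12 * e + 28)%nat in s1 by lia.
  replace (12 * e + 28 - (4 * e + 7) + e)%nat with (9 * e + 21)%nat in s2 by lia.
  replace (9 * e + 21 + (9 * e + 21))%nat with (18 * e + 42)%nat by lia.
  set (w := 1 - exp (- c * INR (4 * e + 14))) in *.
  assert (hw : 1 / 6 <= w).
  { assert (h : 1 / 5 <= c * INR (4 * e + 14)).
    { apply Rle_trans with (c * (8 * X)); [|apply Rmult_le_compat_l; [lra|]].
      - replace (c * (8 * X)) with (8 * (c * X)) by ring; rewrite hcX; nra.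
      - rewrite plus_INR, mult_INR; unfold X; simpl (INR 4); simpl (INR 14); lra. }
    assert (h1 : exp (- c * INR (4 * e + 14)) <= exp (- (1 / 5))) by (apply exp_le_exp; lra).
    assert (h2 : exp (- (1 / 5)) <= 5 / 6); [|unfold w; lra].
    rewrite exp_Ropp; assert (h3 := exp_ineq1_le (1 / 5)).
    replace (5 / 6) with (/ (1 + 1 / 5)) by field; apply Rinv_le_contravar; lra. }
  assert (p1 := exp_pos (c * INR (18 * e + 42))); assert (p2 := exp_pos (c * INR (12 * e + 28))).
  set (f0 := INR (@bsize M (18 * e + 42))) in *; set (f1 := INR (@bsize M (12 * e + 28))) in *.
  set (f2 := INR (@bsize M (9 * e + 21))) in *.
  assert (q0 : 0 <= f0) by apply pos_INR; assert (q1 : 0 <= f1) by apply pos_INR.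
  assert (q2 : 0 <= f2) by apply pos_INR.
  assert (t1 : f0 <= 6 * exp (c * INR (18 * e + 42)) * f1) by nra.
  assert (t2 : f1 <= 6 * exp (c * INR (12 * e + 28)) * f2) by nra.
  assert (t3 : exp (c * INR (18 * e + 42)) * exp (c * INR (12 * e + 28)) <=
               27 / 4 * exp (72 * H * X)).
  { rewrite <- exp_plus; apply Rle_trans with (exp (7 / 4 + 72 * H * X)).
    - apply exp_le_exp; apply Rle_trans with (c * (70 * X)).
      + rewrite <- Rmult_plus_distr_l; apply Rmult_le_compat_l; [lra|].
        rewrite !plus_INR, !mult_INR, !INR_IZR_INZ; unfold X; simpl (IZR _).
        rewrite <- INR_IZR_INZ; lra.
      + replace (c * (70 * X)) with (70 * (c * X)) by ring; rewrite hcX.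
        assert (0 < H * X) by now apply Rmult_lt_0_compat. lra.
    - rewrite exp_plus; apply Rmult_le_compat_r; [left; apply exp_pos | apply exp_seven_quarters]. }
  apply Rle_trans with (36 * (exp (c * INR (18 * e + 42)) * exp (c * INR (12 * e + 28))) * f2).
  - eapply Rle_trans; [exact t1|].
    replace (36 * (exp (c * INR (18 * e + 42)) * exp (c * INR (12 * e + 28))) * f2)
      with (6 * exp (c * INR (18 * e + 42)) * (6 * exp (c * INR (12 * e + 28)) * f2)) by ring.
    apply Rmult_le_compat_l; [lra | exact t2].
  - apply Rmult_le_compat_r; auto; lra.
Qed.

(** * Centralizers *)

(** For nontrivial elements, an algebraic substitute for having the same pair of fixed points at
    infinity. *)
Definition commens {M : MarkedGroup} (g h : mg_carrier M) : Prop :=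
  exists n m : Z, n <> 0%Z /\ m <> 0%Z /\ zpow g n = zpow h m.

Lemma commens_sym {M : MarkedGroup} (g h : mg_carrier M) : commens g h -> commens h g.
Proof. intros [n [m [hn [hm e]]]]; exists m, n; auto. Qed.

Lemma commens_trans {M : MarkedGroup} (g h k : mg_carrier M) :
  commens g h -> commens h k -> commens g k.
Proof.
  intros [n [m [hn [hm e]]]] [i [j [hi [hj e']]]].
  exists (n * i)%Z, (j * m)%Z; split; [nia|split; [nia|]].
  now rewrite !zpow_mul, e, <- zpow_mul, Z.mul_comm, zpow_mul, e'.
Qed.

Lemma commens_conj {M : MarkedGroup} (a g h : mg_carrier M) :
  commens g h -> commens (a ** g ** inv a) (a ** h ** inv a).
Proof.
  intros [n [m [hn [hm e]]]]; exists n, m; split; [|split]; auto.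
  now rewrite !zpow_conj, e.
Qed.

Section Centralizers.
Context {M : MarkedGroup} (tf : torsion_free M) (e : nat) (h4 : four_pt M e).
Local Notation G := (mg_carrier M).

Lemma four_pt_base (a g h k : G) :
  (dn g h + dn a k <= Nat.max (dn a h + dn g k) (dn a g + dn k h) + e)%nat.
Proof.
  assert (t := h4 (inv a ** g) (inv a ** h) (inv a ** k)).
  now rewrite !dn_mul_l in t.
Qed.

Lemma powers_unbounded (h : G) (n : nat) : h <> one -> exists k, (n < wlen M (gpow h k))%nat.
Proof.
  intros hh; apply NNPP; intros hn.
  assert (t : (length (map (gpow h) (seq 0 (S (@bsize M n)))) <= @bsize M n)%nat).
  { apply bsize_ge.
    - apply NoDup_map_inj; [|apply seq_NoDup]; intros a b _ _; now apply gpow_inj.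
    - intros g hg; apply in_map_iff in hg; destruct hg as [k [<- _]].
      apply Nat.nlt_ge; intros hk; apply hn; eauto. }
  rewrite length_map, length_seq in t; lia.
Qed.

(* All [x] in [X] translate the long geodesic from [1] to a power [w] of [h] to a geodesic with
   nearby end points; its point [p] is then moved along the geodesic, up to [3 * e], so that
   [x ** p] is determined coarsely by its distance to [1]. *)
Lemma centralizer_linear_growth (h : G) (s : nat) (X : list G) :
  h <> one -> NoDup X -> (forall x, In x X -> commute x h /\ (wlen M x <= s)%nat) ->
  (length X <= (2 * s + 1) * @bsize M (3 * e))%nat.
Proof.
  intros hh nd hX.
  destruct (powers_unbounded h (2 * s) hh) as [k hk].
  set (w := gpow h k) in *.
  destruct (geodesic_point w s) as [p [hp1 hp2]]; [lia|].
  (* As [x] commutes with [w], the quadrilateral [1], [w], [x ** w], [x] has two opposite sides of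
     length at most [s]. Two four-point inequalities in it show that passing through [x ** p]
     lengthens the way from [1] to [w] by at most [2 * e]; [2 * s < |w|] settles the maximum in the
     second. *)
  assert (hd : forall x, In x X -> (wlen M (x ** p) + dn w (x ** p) <= wlen M w + 2 * e)%nat).
  { intros x hx; destruct (hX x hx) as [hc hs].
    assert (hw : x ** w = w ** x).
    { unfold w; rewrite <- zpow_of_nat; now apply commute_zpow. }
    assert (t1 := four_pt_base one x w (x ** p)); rewrite !dn_1 in t1.
    assert (t2 := four_pt_base w (x ** w) x (x ** p)).
    assert (e1 : dn x (x ** p) = s) by (unfold dn; now rewrite mulKl).
    assert (e2 : dn (x ** w) (x ** p) = (wlen M w - s)%nat) by (rewrite dn_mul_l, dn_sym; exact hp2).
    assert (e3 : dn (x ** w) x = wlen M w).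
    { unfold dn; rewrite <- (wlen_inv w); f_equal; grp. }
    assert (e4 : dn w (x ** w) = wlen M x) by (unfold dn; rewrite hw; f_equal; grp).
    assert (e5 : dn (x ** p) x = s) by (rewrite dn_sym; exact e1).
    assert (t3 := dn_tri x w (x ** w)).
    assert (t4 := dn_tri one x w); rewrite !dn_1 in t4.
    assert (t5 := dn_tri (x ** p) (x ** w) w).
    rewrite (dn_sym (x ** p) (x ** w)), (dn_sym (x ** w) w), (dn_sym (x ** p) w) in t5.
    rewrite (dn_sym w x), (dn_sym (x ** p) w) in *; lia. }
  replace (2 * s + 1)%nat with (length (seq 0 (2 * s + 1))) by apply length_seq.
  apply (pigeonhole_fibres (fun x => wlen M (x ** p))); auto.
  - intros x hx; apply in_seq; destruct (hX x hx) as [_ hs].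
    assert (t := wlen_mul x p); lia.
  (* Two such points at equal distance from [1] are within [3 * e]: the excess [2 * e] plus one more
     four-point error. *)
  - intros r l nl il hl; destruct l as [|x0 l]; [simpl; lia|].
    rewrite <- (length_map (fun x => inv (x0 ** p) ** (x ** p))); apply bsize_ge.
    + apply NoDup_map_inj; auto; intros a b _ _ hab; now apply mulIl, mulIr in hab.
    + intros g hg; apply in_map_iff in hg; destruct hg as [x [<- hx]].
      assert (i0 : In x0 (x0 :: l)) by now left.
      assert (a1 := hd x0 (il _ i0)); assert (a2 := hd x (il _ hx)).
      assert (b1 := hl x0 i0); assert (b2 := hl x hx); simpl in b1, b2.
      assert (t := h4 (x0 ** p) (x ** p) w); rewrite (dn_sym _ w) in t.
      fold (dn (x0 ** p) (x ** p)); lia.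
Qed.

(** The elements [t ** gpow w i] with [i < Q] are distinct and lie in a ball of the centralizer of
    [h] of radius [s + Q * |w|]. Linear growth bounds [#T * Q], and for large [Q] only the slope
    [2 * #B(3e) * |w|] matters. *)
Lemma length_transversal_le (h w : G) (T : list G) :
  h <> one -> commute w h -> NoDup T -> (forall t, In t T -> commute t h) ->
  (forall t t' i j, In t T -> In t' T -> t ** gpow w i = t' ** gpow w j -> t = t' /\ i = j) ->
  (length T <= 2 * @bsize M (3 * e) * wlen M w)%nat.
Proof.
  intros hh hw nd hT inj.
  assert (hs : exists s, forall t, In t T -> (wlen M t <= s)%nat).
  { clear; induction T as [|t T [s hs]]; [exists 0%nat; intros t []|].
    exists (wlen M t + s)%nat; intros t' [<-|ht]; [lia | specialize (hs _ ht); lia]. }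
  destruct hs as [s hs]; set (F := @bsize M (3 * e)).
  assert (hQ : forall Q, (length T * Q <= (2 * (s + Q * wlen M w) + 1) * F)%nat).
  { intros Q.
    set (X := map (fun p => fst p ** gpow w (snd p)) (list_prod T (seq 0 Q))).
    assert (hl : length X = (length T * Q)%nat).
    { unfold X; now rewrite length_map, length_prod, length_seq. }
    rewrite <- hl; apply (centralizer_linear_growth h); auto.
    - apply NoDup_map_inj; [|apply NoDup_list_product; auto; apply seq_NoDup].
      intros [t i] [t' j] h1 h2; apply in_prod_iff in h1, h2; simpl; intros h3.
      apply inj in h3; [destruct h3; congruence | tauto | tauto].
    - intros x hx; apply in_map_iff in hx; destruct hx as [[t i] [<- hti]].
      apply in_prod_iff in hti; destruct hti as [ht hi]; apply in_seq in hi; simpl; split.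
      + apply commute_sym, commute_mul; apply commute_sym; [now apply hT|].
        apply commute_sym; rewrite <- zpow_of_nat; apply commute_zpow; now apply commute_sym.
      + assert (a1 := wlen_mul t (gpow w i)); assert (a2 := wlen_gpow w i).
        specialize (hs t ht); nia. }
  specialize (hQ ((2 * s + 1) * F + 1)%nat).
  apply Nat.nlt_ge; intros hlt; nia.
Qed.

(** Otherwise the powers of [x] would lie in distinct cosets of the powers of [y], giving
    arbitrarily large transversals. *)
Lemma commute_commens (x y : G) : x <> one -> y <> one -> commute x y -> commens x y.
Proof.
  intros hx hy hc; apply NNPP; intros hn.
  set (T := map (gpow x) (seq 0 (S (2 * @bsize M (3 * e) * wlen M y)))).
  assert (hl : length T = S (2 * @bsize M (3 * e) * wlen M y)).
  { unfold T; now rewrite length_map, length_seq. }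
  assert (h := length_transversal_le x y T hx (commute_sym _ _ hc)); rewrite hl in h.
  apply (Nat.nle_succ_diag_l (2 * @bsize M (3 * e) * wlen M y)), h.
  - apply NoDup_map_inj; [|apply seq_NoDup]; intros a b _ _; now apply gpow_inj.
  - intros t ht; apply in_map_iff in ht; destruct ht as [i [<- _]].
    rewrite <- zpow_of_nat; apply commute_sym, commute_zpow; reflexivity.
  - intros t t' i j ht ht' hij; apply in_map_iff in ht, ht'.
    destruct ht as [a [<- _]], ht' as [b [<- _]].
    rewrite <- !zpow_of_nat in *.
    assert (hz : zpow x (Z.of_nat a - Z.of_nat b) = zpow y (Z.of_nat j - Z.of_nat i)).
    { apply (mulIl (zpow x (Z.of_nat b))), (mulIr (zpow y (Z.of_nat i))).
      rewrite <- zpow_add, mulA, <- zpow_add.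
      replace (Z.of_nat b + (Z.of_nat a - Z.of_nat b))%Z with (Z.of_nat a) by lia.
      replace (Z.of_nat j - Z.of_nat i + Z.of_nat i)%Z with (Z.of_nat j) by lia; exact hij. }
    assert (hab : a = b).
    { destruct (Nat.eq_dec a b) as [|hab]; auto; exfalso.
      destruct (Nat.eq_dec i j) as [->|hi].
      - rewrite Z.sub_diag in hz; apply (zpow_eq_one tf) in hz; auto; lia.
      - apply hn; exists (Z.of_nat a - Z.of_nat b)%Z, (Z.of_nat j - Z.of_nat i)%Z.
        split; [lia|split; [lia|exact hz]]. }
    subst b; split; auto; apply mulIl, (zpow_inj tf) in hij; auto; lia.
Qed.

(** The elements [1, z, ..., z^(n-1)] form a transversal for the powers of [z^n], so [n] is bounded
    by a multiple of [|z^n|]. In other words, [z] has positive stable length. *)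
Lemma wlen_zpow_lower (z : G) (i : Z) : z <> one ->
  (Z.abs_nat i <= 2 * @bsize M (3 * e) * wlen M (zpow z i))%nat.
Proof.
  intros hz.
  assert (hn : forall n : nat, (n <= 2 * @bsize M (3 * e) * wlen M (gpow z n))%nat).
  { intros n.
    rewrite <- (length_seq n 0) at 1; rewrite <- (length_map (gpow z)).
    apply (length_transversal_le z); auto.
    - rewrite <- zpow_of_nat; apply commute_sym, commute_zpow; reflexivity.
    - apply NoDup_map_inj; [|apply seq_NoDup]; intros a b _ _; now apply gpow_inj.
    - intros t ht; apply in_map_iff in ht; destruct ht as [i' [<- _]].
      rewrite <- zpow_of_nat; apply commute_sym, commute_zpow; reflexivity.
    - intros t t' k l ht ht' hij; apply in_map_iff in ht, ht'.
      destruct ht as [a [<- ha]], ht' as [b [<- hb]]; apply in_seq in ha, hb.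
      rewrite <- !zpow_of_nat, <- !zpow_mul, <- !zpow_add in hij.
      apply (zpow_inj tf) in hij; auto.
      assert (hkl : k = l) by (destruct (Nat.lt_trichotomy k l) as [|[|]]; [nia | auto | nia]).
      subst l; split; auto; f_equal; lia. }
  destruct (Z_le_gt_dec 0 i) as [h|h].
  - rewrite <- (Z2Nat.id i h), zpow_of_nat; rewrite Zabs2Nat.id; apply hn.
  - replace i with (- Z.of_nat (Z.abs_nat i))%Z at 2 by lia.
    rewrite zpow_opp, wlen_inv, zpow_of_nat; apply hn.
Qed.

Lemma wlen_zpow (z : G) (i : Z) : (wlen M (zpow z i) <= Z.abs_nat i * wlen M z)%nat.
Proof.
  destruct (Z_le_gt_dec 0 i) as [h|h].
  - rewrite <- (Z2Nat.id i h), zpow_of_nat, Zabs2Nat.id; apply wlen_gpow.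
  - replace i with (- Z.of_nat (Z.abs_nat i))%Z at 1 by lia.
    rewrite zpow_opp, wlen_inv, zpow_of_nat; apply wlen_gpow.
Qed.

Lemma conj_zpow_iter (a z : G) (n m : Z) (k : nat) :
  a ** zpow z n ** inv a = zpow z m ->
  gpow a k ** zpow z (n ^ Z.of_nat k) ** inv (gpow a k) = zpow z (m ^ Z.of_nat k).
Proof.
  intros h; induction k as [|k IH].
  - change (gpow a 0) with (one : G); simpl; grp.
  - rewrite Nat2Z.inj_succ, !Z.pow_succ_r by lia.
    rewrite (Z.mul_comm n), gpow_S, zpow_mul.
    replace (a ** gpow a k ** zpow (zpow z (n ^ Z.of_nat k)) n ** inv (a ** gpow a k))
      with (a ** (gpow a k ** zpow (zpow z (n ^ Z.of_nat k)) n ** inv (gpow a k)) ** inv a) by grp.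
    rewrite <- zpow_conj, IH, <- !zpow_mul, (Z.mul_comm (m ^ _) n), zpow_mul, <- zpow_conj.
    now rewrite h, <- zpow_mul.
Qed.

(* The length of [z ^ k] is comparable to [k], so that conjugation cannot stretch powers. *)
Lemma conj_zpow_abs_le (a z : G) (n m : Z) : z <> one -> n <> 0%Z ->
  a ** zpow z n ** inv a = zpow z m -> (Z.abs m <= Z.abs n)%Z.
Proof.
  intros hz hn h; apply Z.nlt_ge; intros hlt.
  set (F := (2 * @bsize M (3 * e))%nat).
  set (q := INR (Z.abs_nat m) / INR (Z.abs_nat n)).
  assert (hn0 : 1 <= INR (Z.abs_nat n)) by (replace 1 with (INR 1) by auto; apply le_INR; lia).
  assert (hq : 1 < q).
  { unfold q; apply (Rmult_lt_reg_r (INR (Z.abs_nat n))); [lra|].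
    unfold Rdiv; rewrite Rmult_assoc, Rinv_l by lra.
    rewrite Rmult_1_l, Rmult_1_r; apply lt_INR; lia. }
  destruct (pow_beats_linear q (2 * INR F * INR (wlen M a)) (INR F * INR (wlen M z)) hq) as [k hk].
  apply (Rlt_irrefl (q ^ k)); eapply Rle_lt_trans; [|exact hk].
  assert (hlow := wlen_zpow_lower z (m ^ Z.of_nat k) hz).
  rewrite <- (conj_zpow_iter a z n m k h) in hlow.
  assert (u1 := wlen_mul (gpow a k ** zpow z (n ^ Z.of_nat k)) (inv (gpow a k))).
  assert (u2 := wlen_mul (gpow a k) (zpow z (n ^ Z.of_nat k))).
  assert (u3 := wlen_gpow a k); assert (u4 := wlen_zpow z (n ^ Z.of_nat k)).
  rewrite wlen_inv in u1.
  assert (hp : forall x : Z, Z.abs_nat (x ^ Z.of_nat k) = (Z.abs_nat x ^ k)%nat).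
  { intros x; clear; induction k as [|k IH]; [reflexivity|].
    rewrite Nat2Z.inj_succ, Z.pow_succ_r, Zabs2Nat.inj_mul, IH by lia; reflexivity. }
  rewrite hp in hlow, u4; fold F in hlow.
  assert (hf : (Z.abs_nat m ^ k <= F * (2 * k * wlen M a + Z.abs_nat n ^ k * wlen M z))%nat).
  { eapply Nat.le_trans; [exact hlow|]; apply Nat.mul_le_mono_l; lia. }
  apply le_INR in hf; rewrite !mult_INR, plus_INR, !mult_INR, !pow_INR in hf; simpl (INR 2) in hf.
  set (N := INR (Z.abs_nat n)) in *.
  assert (hN : 1 <= N ^ k) by now apply pow_R1_Rle.
  replace (INR (Z.abs_nat m)) with (q * N) in hf by (unfold q; field; lra).
  rewrite Rpow_mult_distr in hf.
  assert (p1 := pos_INR F); assert (p2 := pos_INR k); assert (p3 := pos_INR (wlen M a)).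
  apply (Rmult_le_reg_r (N ^ k)); [lra|].
  eapply Rle_trans; [exact hf|].
  assert (p4 : 0 <= 2 * INR F * INR (wlen M a) * INR k) by (repeat apply Rmult_le_pos; lra).
  assert (p5 : 2 * INR F * INR (wlen M a) * INR k * 1 <= 2 * INR F * INR (wlen M a) * INR k * N ^ k)
    by (now apply Rmult_le_compat_l).
  lra.
Qed.

(** Conjugation by [a] and by [inv a] cannot stretch, so [m = n] or [m = - n]. In the second case
    [a ** a] commutes with [w = zpow z n], hence shares a nontrivial power with it; [a] then both
    centralizes and inverts this power, against torsion-freeness. *)
Lemma conj_commens_commute (a z : G) : z <> one -> commens (a ** z ** inv a) z ->
  exists n : Z, n <> 0%Z /\ commute a (zpow z n).
Proof.
  intros hz [n [m [hn [hm h]]]]; rewrite zpow_conj in h.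
  assert (h1 := conj_zpow_abs_le a z n m hz hn h).
  assert (h' : inv a ** zpow z m ** inv (inv a) = zpow z n) by (rewrite <- h; grp).
  assert (h2 := conj_zpow_abs_le (inv a) z m n hz hm h').
  exists n; split; auto.
  assert (hc : m = n \/ m = (- n)%Z) by lia; destruct hc as [->|hc].
  - unfold commute; rewrite <- h at 2; grp.
  - destruct (classic (a = one)) as [->|ha]; [unfold commute; grp|]; exfalso.
    rewrite hc, zpow_opp in h; clear hc h1 h2 h' hm m.
    assert (hw : zpow z n <> one) by (intros hw; now apply (zpow_eq_one tf) in hw).
    assert (ha2 : a ** a <> one).
    { intros h2; assert (t : 2%Z = 0%Z); [|discriminate t].
      apply (zpow_eq_one tf a); auto.
      change 2%Z with (1 + 1)%Z; now rewrite zpow_add, zpow_1. }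
    set (w := zpow z n) in *.
    assert (hca : a ** w = inv w ** a) by (rewrite <- h; grp).
    assert (hci : a ** inv w = w ** a).
    { apply (mulIl (inv w)); rewrite <- mulA, <- hca; grp. }
    assert (hc2 : commute (a ** a) w).
    { unfold commute; rewrite mulA, hca, <- mulA, hci; grp. }
    destruct (commute_commens (a ** a) w ha2 hw hc2) as [i [j [hi [hj hij]]]].
    assert (h3 : commute a (zpow w j)).
    { rewrite <- hij; apply commute_zpow; unfold commute; grp. }
    assert (h4' : zpow (a ** w ** inv a) j = zpow w (- j)).
    { rewrite h, <- (zpow_1 (inv w)), <- zpow_mul.
      replace (inv w) with (zpow w (-1)); [|change (-1)%Z with (- (1))%Z; now rewrite zpow_opp, zpow_1].
      rewrite <- zpow_mul; f_equal; lia. }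
    rewrite zpow_conj, h3, mulA, mulVr, mul1r in h4'.
    apply (zpow_inj tf) in h4'; auto; lia.
Qed.

End Centralizers.

(* Transfer homomorphism into a central infinite cyclic subgroup of finite index. *)
Lemma transfer_exists {M : MarkedGroup} (tf : torsion_free M) (w : mg_carrier M) (B : nat) :
  w <> one -> (forall g, commute g w) ->
  (forall T : list (mg_carrier M), NoDup T ->
     (forall t t' k, In t T -> In t' T -> t = t' ** zpow w k -> t = t') -> (length T <= B)%nat) ->
  exists V : mg_carrier M -> Z, (forall x y, V (x ** y) = (V x + V y)%Z) /\ (0 < V w)%Z.
Proof.
  intros hw hc hB.
  set (good := fun T : list (mg_carrier M) => NoDup T /\
     forall t t' k, In t T -> In t' T -> t = t' ** zpow w k -> t = t').
  (* A largest set of elements inequivalent modulo the powers of [w] represents every coset. *)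
  destruct (nat_max_exists (fun n => exists T, good T /\ length T = n) B) as [n [[T [[nd hT] hl]] hmax]].
  - exists 0%nat, nil; split; [split; [constructor | intros t t' k []] | reflexivity].
  - intros n [T [[h1 h2] <-]]; now apply hB.
  - assert (hrep : forall g, exists p : mg_carrier M * Z, In (fst p) T /\ g = fst p ** zpow w (snd p)).
    { intros g; apply NNPP; intros hn.
      assert (h : (S n <= n)%nat); [|lia].
      apply hmax; exists (g :: T); split; [split|simpl; lia].
      - constructor; auto; intros hg; apply hn; exists (g, 0%Z); simpl; split; auto; grp.
      - intros t t' k [<-|ht] [<-|ht'] hk; auto.
        + exfalso; apply hn; exists (t', k); auto.
        + exfalso; apply hn; exists (t, (- k)%Z); simpl; split; auto.
          rewrite hk, mulA, <- zpow_add; replace (k + - k)%Z with 0%Z by lia; simpl; grp.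
        + now apply hT in hk. }
    set (rp := fun g => proj1_sig (constructive_indefinite_description _ (hrep g))).
    assert (hrp : forall g, In (fst (rp g)) T /\ g = fst (rp g) ** zpow w (snd (rp g))).
    { intros g; unfold rp; now destruct constructive_indefinite_description. }
    assert (huniq : forall t k, In t T -> rp (t ** zpow w k) = (t, k)).
    { intros t k ht; destruct (hrp (t ** zpow w k)) as [h1 h2].
      destruct (rp (t ** zpow w k)) as [t' k']; simpl in *.
      assert (e : t = t').
      { apply (hT t t' (k' - k)%Z); auto; apply (mulIr (zpow w k)).
        rewrite h2, mulA, <- zpow_add; do 2 f_equal; lia. }
      subst t'; apply mulIl, (zpow_inj tf) in h2; subst; auto. }
    assert (hshift : forall g k, rp (g ** zpow w k) = (fst (rp g), (snd (rp g) + k)%Z)).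
    { intros g k; destruct (hrp g) as [h1 h2]; rewrite h2 at 1.
      rewrite mulA, <- zpow_add; now apply huniq. }
    (* The transfer in additive form: left translation by [x] permutes the cosets, and [V x] adds up
       the exponents of [w] that it creates. For [x = w] each of them is [1], as [w] is central. *)
    exists (fun x => zsum (fun t => snd (rp (x ** t))) T); split.
    + intros x y; assert (hp : Permutation (map (fun t => fst (rp (y ** t))) T) T).
      { apply NoDup_Permutation_bis.
        - apply NoDup_map_inj; auto; intros a b ha hb hab.
          destruct (hrp (y ** a)) as [_ h1]; destruct (hrp (y ** b)) as [_ h2].
          rewrite hab in h1; revert h1 h2.
          generalize (fst (rp (y ** b))) (snd (rp (y ** a))) (snd (rp (y ** b))).
          intros r i j h1 h2; apply (hT a b (i - j)%Z); auto.
          apply (mulIl y); rewrite <- mulA, h2, h1, mulA, <- zpow_add; do 2 f_equal; lia.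
        - rewrite length_map; auto.
        - intros t ht; apply in_map_iff in ht; destruct ht as [s [<- _]]; apply hrp. }
      assert (hx : zsum (fun t => snd (rp (x ** t))) T =
                   zsum (fun t => snd (rp (x ** fst (rp (y ** t))))) T).
      { rewrite <- (zsum_map (fun t => snd (rp (x ** t))) (fun t => fst (rp (y ** t)))).
        symmetry; apply zsum_perm, hp. }
      rewrite hx, <- zsum_plus; apply zsum_ext; intros t _.
      destruct (hrp (y ** t)) as [_ h2]; rewrite mulA; rewrite h2 at 1.
      rewrite <- mulA, hshift; reflexivity.
    + rewrite (zsum_ext _ (fun _ => 1%Z)), zsum_const1.
      * assert (h1 := proj1 (hrp one)); destruct T; [destruct h1 | simpl; lia].
      * intros t ht; rewrite <- (hc t); rewrite <- (zpow_1 w).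
        now rewrite huniq.
Qed.

Lemma additive_zpow {M : MarkedGroup} (V : mg_carrier M -> Z) :
  (forall x y, V (x ** y) = (V x + V y)%Z) -> forall g k, V (zpow g k) = (V g * k)%Z.
Proof.
  intros hV g; assert (h0 : V one = 0%Z) by (assert (t := hV one one); rewrite mul1l in t; lia).
  apply Z.peano_ind; [simpl; lia | |]; intros k IH.
  - rewrite zpow_succ, hV, IH; lia.
  - assert (t := hV (zpow g (Z.pred k)) g); rewrite <- zpow_succ, Z.succ_pred in t; lia.
Qed.

Lemma cyclic_of_injective_int {M : MarkedGroup} (V : mg_carrier M -> Z) (w : mg_carrier M) :
  (forall x y, V (x ** y) = (V x + V y)%Z) -> (forall x, V x = 0%Z -> x = one) -> (0 < V w)%Z ->
  cyclic M.
Proof.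
  intros hV hi hw.
  assert (hz := additive_zpow V hV).
  assert (hm : exists g, (0 < V g)%Z /\ forall h, (0 < V h)%Z -> (V g <= V h)%Z).
  { assert (hn : exists n, exists g, (0 < V g)%Z /\ Z.to_nat (V g) = n) by eauto.
    destruct hn as [n hn]; revert hn; induction n as [n IH] using lt_wf_ind; intros [g [hg e]].
    destruct (classic (exists h, (0 < V h < V g)%Z)) as [[h hh]|hno].
    - apply (IH (Z.to_nat (V h))); [lia|]; exists h; split; auto; lia.
    - exists g; split; auto; intros h hh; apply Z.nlt_ge; intros hlt; apply hno; eauto. }
  destruct hm as [g [hg hmin]]; exists g; intros h.
  set (q := (V h / V g)%Z).
  assert (hq := Z.div_mod (V h) (V g) ltac:(lia)); assert (hb := Z.mod_pos_bound (V h) (V g) hg).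
  assert (hr : V (h ** zpow g (- q)) = (V h mod V g)%Z) by (rewrite hV, hz; unfold q; lia).
  assert (h0 : h ** zpow g (- q) = one).
  { apply hi; destruct (Z_le_gt_dec (V (h ** zpow g (- q))) 0) as [hl|hl]; [lia|].
    specialize (hmin (h ** zpow g (- q)) ltac:(lia)); lia. }
  assert (e : h = zpow g q).
  { rewrite <- (mul1l (zpow g q)), <- h0, mulA, <- zpow_add.
    replace (- q + q)%Z with 0%Z by lia; simpl; grp. }
  rewrite e; destruct q as [|p|p].
  - exists 0%nat; left; reflexivity.
  - exists (Pos.to_nat p); left; reflexivity.
  - exists (Pos.to_nat p); right; reflexivity.
Qed.

(** If every generator kept the commensurability class of [z], each would commute with a power of
    [z], and a common power [w] would be central. Its powers would have finite index, and the
    transfer to [Z] would be injective since every nontrivial element is commensurable to [w]; so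
    the group would be cyclic. *)
Lemma not_cyclic_exists_gen {M : MarkedGroup} (tf : torsion_free M) (e : nat) (h4 : four_pt M e)
  (nc : ~ cyclic M) (z : mg_carrier M) : z <> one ->
  exists a, In a (mg_gens M) /\ ~ commens (a ** z ** inv a) z.
Proof.
  intros hz; apply NNPP; intros hn; apply nc.
  assert (hall : forall a, In a (mg_gens M) -> exists n : Z, n <> 0%Z /\ commute a (zpow z n)).
  { intros a ha; apply (conj_commens_commute tf e h4); auto.
    apply NNPP; intros hc; apply hn; eauto. }
  assert (hN : exists n : Z, n <> 0%Z /\ forall a, In a (mg_gens M) -> commute a (zpow z n)).
  { revert hall; generalize (mg_gens M); clear; induction l as [|a l IH]; intros hall.
    - exists 1%Z; split; [lia | intros a []].
    - destruct IH as [n [hn h1]]; [intros; apply hall; now right|].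
      destruct (hall a (or_introl eq_refl)) as [m [hm h2]].
      exists (n * m)%Z; split; [nia|]; intros b [<-|hb].
      + rewrite Z.mul_comm, zpow_mul; now apply commute_zpow.
      + rewrite zpow_mul; apply commute_zpow; auto. }
  destruct hN as [n [hn0 hc]]; set (w := zpow z n) in *.
  assert (hw : w <> one) by (intros h; now apply (zpow_eq_one tf) in h).
  assert (hcent : forall g, commute g w).
  { intros g; destruct (mg_gens_gen M g) as [u [hu <-]].
    induction u as [|a u IH]; [apply commute_sym, commute_one|].
    simpl; apply commute_sym, commute_mul; apply commute_sym.
    - apply hc, hu; now left.
    - apply IH; intros; apply hu; now right. }
  destruct (transfer_exists tf w (2 * @bsize M (3 * e) * wlen M w)%nat hw hcent) as [V [hV hVw]].
  - intros T nd hT; apply (length_transversal_le tf e h4 w); auto.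
    intros t t' i j ht ht' hij; rewrite <- !zpow_of_nat in hij.
    assert (ett : t = t').
    { apply (hT t t' (Z.of_nat j - Z.of_nat i)%Z); auto; apply (mulIr (zpow w (Z.of_nat i))).
      rewrite hij, mulA, <- zpow_add; do 2 f_equal; lia. }
    subst t'; split; auto; apply mulIl, (zpow_inj tf) in hij; auto; lia.
  - apply (cyclic_of_injective_int V w hV); auto.
    intros x hx; apply NNPP; intros hx1.
    destruct (commute_commens tf e h4 x w hx1 hw (hcent x)) as [i [j [hi [hj hij]]]].
    assert (hz' := additive_zpow V hV).
    assert (t := hz' x i); rewrite hij, hz' in t; nia.
Qed.

(** * Nilpotent coverings *)

Lemma lcs_sub {M : MarkedGroup} (G0 : mg_carrier M -> Prop) k :
  subgroupP mg_mul mg_inv mg_one G0 -> forall x, lcs mg_mul mg_inv mg_one G0 k x -> G0 x.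
Proof.
  intros [h1 [h2 h3]]; induction k as [|k IH]; simpl; auto.
  intros x [w [hw <-]].
  assert (hc : forall z, (exists x y, lcs mg_mul mg_inv mg_one G0 k x /\ G0 y /\
                            z = commg mg_mul mg_inv x y) -> G0 z).
  { intros z [a [b [ha [hb ->]]]]; unfold commg; auto 10. }
  induction w as [|y w IHw]; simpl; auto.
  apply h2; [|apply IHw; intros; apply hw; now right].
  destruct (hw y (or_introl eq_refl)) as [h|h]; apply hc in h; auto.
  rewrite <- (inv_inv y); auto.
Qed.

(** The last nontrivial term of the lower central series is central. *)
Lemma nilpotent_center {M : MarkedGroup} (G0 : mg_carrier M -> Prop) c :
  subgroupP mg_mul mg_inv mg_one G0 -> (forall x, lcs mg_mul mg_inv mg_one G0 c x -> x = one) ->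
  (forall x, G0 x -> x = one) \/
  exists z, G0 z /\ z <> one /\ forall y, G0 y -> commute z y.
Proof.
  intros hG; induction c as [|c IH]; intros h; [now left|].
  destruct (classic (forall x, lcs mg_mul mg_inv mg_one G0 c x -> x = one)) as [h'|h']; auto.
  right; apply not_all_ex_not in h'; destruct h' as [z hz].
  apply imply_to_and in hz; destruct hz as [hz1 hz2].
  exists z; split; [now apply (lcs_sub G0 c)|split; auto].
  intros y hy; assert (hc : commg mg_mul mg_inv z y = one).
  { apply h; simpl; exists (commg mg_mul mg_inv z y :: nil); split.
    - intros t [<-|[]]; left; eauto.
    - simpl; grp. }
  unfold commg in hc; unfold commute; apply (mulIl (inv z ** inv y)); rewrite hc, <- mulVl with (x := y ** z).
  rewrite inv_mul; grp.
Qed.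

(* [X = G0 cap B(2)] injects into the set of cosets: otherwise for every generator [a] two
   elements [a ** h1 ** inv a], [a ** h2 ** inv a] lie in the same coset, so that [G0] and
   [a ** G0 ** inv a] share a nontrivial element, and [a] preserves the commensurability
   class of the center of [G0]. *)
Lemma bsize_1_le (nu : R -> nat) (hnu : BGT_property nu) (M : MarkedGroup) (e r : nat) (K : R) :
  torsion_free M -> ~ cyclic M -> four_pt M e -> 1 <= K -> (4 <= r)%nat ->
  INR (@bsize M (r + r)) <= K * INR (@bsize M r) -> (@bsize M 1 <= nu K * nu K)%nat.
Proof.
  intros tf nc h4 hK hr hdbl.
  destruct (hnu K hK) as [rk hB].
  assert (hne : @ball M r <> nil).
  { intros h; assert (t := @bsize_pos M r); unfold bsize in t; rewrite h in t; simpl in t; lia. }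
  destruct (hB (mg_carrier M) mg_mul mg_inv mg_one (mg_is_group M) (@ball M r) (@ball M r)
    hne hne (NoDup_ball r) (NoDup_ball r))
    as [G0 [L [hG [hL [_ [_ [[lL hlL] [[c hc] [_ [ts [hts hcov]]]]]]]]]]].
  { exists (@ball M (r + r)); split.
    - intros a b ha hb; apply In_ball in ha, hb; apply In_ball.
      assert (t := wlen_mul a b); lia.
    - fold (@bsize M (r + r)); fold (@bsize M r).
      rewrite Rmult_assoc, sqrt_def by apply pos_INR; exact hdbl. }
  assert (hL1 := finite_subgroup_trivial tf L lL hL hlL).
  assert (hcen := nilpotent_center G0 c hG (fun x hx => hL1 x (hc x hx))).
  assert (hco : exists co : mg_carrier M -> mg_carrier M, forall a, (wlen M a <= r)%nat ->
            In (co a) ts /\ G0 (inv (co a) ** a)).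
  { exists (fun a => epsilon (inhabits a) (fun t => In t ts /\ G0 (inv t ** a))).
    intros a ha; apply epsilon_spec, hcov; now apply In_ball. }
  destruct hco as [co hco].
  assert (hsame : forall a b, (wlen M a <= r)%nat -> (wlen M b <= r)%nat -> co a = co b ->
            G0 (inv a ** b)).
  { intros a b ha hb hab; destruct (hco a ha) as [_ h1]; destruct (hco b hb) as [_ h2].
    rewrite hab in h1; destruct hG as [_ [g2 g3]].
    replace (inv a ** b) with (inv (inv (co b) ** a) ** (inv (co b) ** b)) by grp; auto. }
  (* The radius is [2] because quotients of two elements of [B(1)] are to be counted. *)
  destruct (NoDup_enum (fun g => G0 g /\ (wlen M g <= 2)%nat) (@ball M 2)) as [X [ndX hX]].
  { intros g [_ hg]; now apply In_ball. }
  assert (hXle : (length X <= length ts)%nat).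
  { destruct hcen as [h1|[z [gz [hz hzc]]]].
    - apply Nat.le_trans with 1%nat.
      + apply (NoDup_incl_length (l' := one :: nil) ndX).
        intros g hg; apply hX in hg; left; symmetry; apply h1; tauto.
      + destruct (hco one) as [h2 _]; [rewrite wlen_one; lia|].
        destruct ts; [destruct h2 | simpl; lia].
    - destruct (not_cyclic_exists_gen tf e h4 nc z hz) as [a [ha hn]].
      apply Nat.nlt_ge; intros hlt.
      (* Here [4 <= r] enters: conjugation by a generator adds at most [2] to a length of at most
         [2]. *)
      assert (hlen : forall h, In h X -> (wlen M (a ** h ** inv a) <= r)%nat).
      { intros h hh; apply hX in hh; assert (t1 := wlen_mul (a ** h) (inv a)).
        assert (t2 := wlen_mul a h); assert (t3 := wlen_gen a ha).
        rewrite wlen_inv in t1; lia. }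
      destruct (not_NoDup_map_eq (fun h => co (a ** h ** inv a)) X ndX) as [u [v [hu [hv [huv heq]]]]].
      { intros nd; apply (NoDup_incl_length (l' := ts)) in nd; [rewrite length_map in nd; lia|].
        intros t ht; apply in_map_iff in ht; destruct ht as [h [<- hh]]; now apply hco, hlen. }
      apply hsame in heq; auto.
      set (h := inv u ** v) in *.
      assert (hh : h <> one) by (intros hh; now apply huv, eq_one_of_inv_mul).
      assert (e1 : inv (a ** u ** inv a) ** (a ** v ** inv a) = a ** h ** inv a) by (unfold h; grp).
      rewrite e1 in heq.
      assert (gh : G0 h).
      { apply hX in hu, hv; destruct hG as [_ [g2 g3]]; unfold h; apply g2; [apply g3|]; tauto. }
      assert (hh' : a ** h ** inv a <> one).
      { intros e2; apply hh, (mulIl a), (mulIr (inv a)); rewrite e2; grp. }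
      apply hn.
      assert (k1 : commens h z) by (apply (commute_commens tf e h4); auto; apply commute_sym; auto).
      assert (k2 : commens (a ** h ** inv a) z)
        by (apply (commute_commens tf e h4); auto; apply commute_sym; auto).
      apply (commens_trans _ (a ** h ** inv a)); auto.
      now apply commens_sym, commens_conj. }
  apply Nat.le_trans with (length ts * length X)%nat; [|nia].
  apply (pigeonhole_fibres co); [apply NoDup_ball | |].
  - intros x hx; apply In_ball in hx; apply hco; lia.
  - intros t l nl il hl; destruct l as [|x0 l]; [simpl; lia|].
    rewrite <- (length_map (fun x => inv x0 ** x)); apply NoDup_incl_length.
    + apply NoDup_map_inj; auto; intros x y _ _; apply mulIl.
    + intros g hg; apply in_map_iff in hg; destruct hg as [x [<- hx]].
      assert (a0 := il x0 (or_introl eq_refl)); assert (a1 := il x hx).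
      apply In_ball in a0, a1; apply hX; split.
      * apply hsame; try lia; rewrite (hl x0), (hl x); auto; now left.
      * assert (t1 := wlen_mul (inv x0) x); rewrite wlen_inv in t1; lia.
Qed.

(** * Presentation by short relations *)

(** A path from [1] with steps of length at most [1] that reaches [g] at time [wlen M g] is
    automatically geodesic. *)
Definition thin_geodesics (M : MarkedGroup) (d : nat) : Prop :=
  exists P : mg_carrier M -> nat -> mg_carrier M,
  (forall g, P g 0%nat = one) /\ (forall g, P g (wlen M g) = g) /\
  (forall g i, (i < wlen M g)%nat -> (dn (P g i) (P g (S i)) <= 1)%nat) /\
  (forall g h i, (2 * i + dn g h <= wlen M g + wlen M h)%nat -> (dn (P g i) (P h i) <= d)%nat).

(* The extra letter [Q] stands for the identity, so that shorter words can be padded. *)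
Definition labelling (M : MarkedGroup) (Q : nat) (eps : nat -> mg_carrier M) : Prop :=
  (forall i, (i < Q)%nat -> In (eps i) (mg_gens M)) /\
  (forall s, In s (mg_gens M) -> exists i, (i < Q)%nat /\ eps i = s) /\ eps Q = one.

Definition ev {M : MarkedGroup} (eps : nat -> mg_carrier M) (w : list nat) : mg_carrier M :=
  wprod mg_mul mg_one (map eps w).

Definition letters (Q : nat) (w : list nat) : Prop := forall i, In i w -> (i <= Q)%nat.

Lemma ev_app {M : MarkedGroup} (eps : nat -> mg_carrier M) u v : ev eps (u ++ v) = ev eps u ** ev eps v.
Proof. unfold ev; now rewrite map_app, wprod_app. Qed.

Lemma ev_cons {M : MarkedGroup} (eps : nat -> mg_carrier M) i v : ev eps (i :: v) = eps i ** ev eps v.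
Proof. reflexivity. Qed.

Lemma letters_app Q u v : letters Q u -> letters Q v -> letters Q (u ++ v).
Proof. intros h1 h2 i hi; apply in_app_or in hi; destruct hi; auto. Qed.

Lemma letters_cons Q i v : (i <= Q)%nat -> letters Q v -> letters Q (i :: v).
Proof. intros h1 h2 j [<-|hj]; auto. Qed.

Lemma letters_nil Q : letters Q nil.
Proof. intros i []. Qed.

Lemma ev_repeat_one {M : MarkedGroup} (eps : nat -> mg_carrier M) Q k :
  eps Q = one -> ev eps (repeat Q k) = one.
Proof.
  intros h; induction k as [|k IH]; [reflexivity|].
  cbn [repeat]; rewrite ev_cons, IH, h; grp.
Qed.

Section Presentation.
Context {M M' : MarkedGroup} {Q d : nat} (eps : nat -> mg_carrier M) (eps' : nat -> mg_carrier M')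
  (hl : labelling M Q eps)
  (hm : forall w, letters Q w -> (length w <= 2 * d + 4)%nat -> ev eps w = one -> ev eps' w = one).
Local Notation G := (mg_carrier M).

Lemma word_exists (g : G) : exists w, letters Q w /\ length w = wlen M g /\ ev eps w = g.
Proof.
  destruct (wlen_word g) as [u [hu [hlen e]]].
  assert (h : exists w, letters Q w /\ length w = length u /\ map eps w = u).
  { clear hlen e; induction u as [|s u IH]; [exists nil; split; [apply letters_nil | auto]|].
    destruct IH as [w [h1 [h2 h3]]]; [intros; apply hu; now right|].
    destruct hl as [_ [hs _]]; destruct (hs s (hu s (or_introl eq_refl))) as [i [hi e]].
    exists (i :: w); split; [apply letters_cons; auto; lia | simpl; split; congruence]. }
  destruct h as [w [h1 [h2 h3]]]; exists w; split; [auto | split; [lia|]].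
  unfold ev; now rewrite h3.
Qed.

(** A priori the letter that inverts [i] depends on the group. It is the same for [eps'] because the
    word [i j] is a relation of length [2], which [hm] transfers. *)
Lemma inverse_word_exists (w : list nat) : letters Q w -> exists w', letters Q w' /\ length w' = length w /\
  ev eps w' = inv (ev eps w) /\ ev eps' w' = inv (ev eps' w).
Proof.
  induction w as [|i w IH]; intros hw.
  - exists nil; split; [apply letters_nil|]; unfold ev; simpl; repeat split; grp.
  - destruct IH as [w' [h1 [h2 [h3 h4]]]]; [intros j hj; apply hw; now right|].
    assert (hi : exists j, (j <= Q)%nat /\ eps j = inv (eps i)).
    { assert (hi := hw i (or_introl eq_refl)); destruct hl as [l1 [l2 l3]].
      destruct (Nat.eq_dec i Q) as [->|hne].
      - exists Q; rewrite l3; split; grp.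
      - destruct (l2 (inv (eps i))) as [j [hj e]]; [apply mg_gens_sym, l1; lia|].
        exists j; split; [lia | auto]. }
    destruct hi as [j [hj e]].
    assert (e' : eps' j = inv (eps' i)).
    { assert (t : ev eps' (i :: j :: nil) = one).
      { apply hm.
        - apply letters_cons; [apply hw; now left|]; apply letters_cons, letters_nil; auto.
        - simpl; lia.
        - unfold ev; simpl; rewrite e; grp. }
      unfold ev in t; simpl in t; rewrite mul1r in t.
      apply (mulIl (eps' i)); now rewrite t, mulVr. }
    exists (w' ++ j :: nil); split; [apply letters_app; auto; apply letters_cons, letters_nil; auto|].
    rewrite length_app, !ev_app, !ev_cons, h2, h3, h4, e, e'; unfold ev; simpl.
    split; [lia | split; grp].
Qed.

Lemma ev_eq_short (u v : list nat) : letters Q u -> letters Q v ->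
  (length u + length v <= 2 * d + 4)%nat -> ev eps u = ev eps v -> ev eps' u = ev eps' v.
Proof.
  intros hu hv hlen e; destruct (inverse_word_exists v hv) as [v' [h1 [h2 [h3 h4]]]].
  apply (mulIr (inv (ev eps' v))); rewrite mulVr, <- h4, <- ev_app; apply hm.
  - now apply letters_app.
  - rewrite length_app; lia.
  - rewrite ev_app, h3, e; grp.
Qed.

(* Consecutive geodesics [P g] and [P (g ** eps l)] form a ladder whose rungs have length at
   most [d]; its cells have perimeter at most [2 * d + 2]. *)
Lemma relation_transfer (thin : thin_geodesics M d) (w : list nat) :
  letters Q w -> ev eps w = one -> ev eps' w = one.
Proof.
  destruct thin as [P [P0 [P1 [Pstep Pthin]]]].
  set (om := fun g => proj1_sig (constructive_indefinite_description _ (word_exists g))).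
  assert (hom : forall g, letters Q (om g) /\ length (om g) = wlen M g /\ ev eps (om g) = g).
  { intros g; unfold om; now destruct constructive_indefinite_description. }
  (* [phi g i] develops in [M'] the path [P g] up to time [i]. Its final value is the intended image
     of [g], available before any homomorphism is known to exist. *)
  set (phi := fix phi (g : G) (i : nat) : mg_carrier M' := match i with
    | O => one
    | S j => phi g j ** ev eps' (om (inv (P g j) ** P g (S j)))
    end).
  assert (hladder : forall g h i, (i <= wlen M g)%nat -> (i <= wlen M h)%nat ->
    (2 * i + dn g h <= wlen M g + wlen M h)%nat ->
    phi g i ** ev eps' (om (inv (P g i) ** P h i)) = phi h i).
  { intros g h; induction i as [|i IH]; intros hg hh hgh.
    - rewrite !P0; simpl.
      destruct (hom (inv one ** one)) as [_ [hlen _]].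
      rewrite mulVl in *; rewrite wlen_one in hlen.
      destruct (om one); [|discriminate]; unfold ev; simpl; grp.
    - cbn [phi]; rewrite <- IH by lia; rewrite !mulA, <- !ev_app; f_equal.
      destruct (hom (inv (P g i) ** P g (S i))) as [a1 [a2 a3]].
      destruct (hom (inv (P h i) ** P h (S i))) as [b1 [b2 b3]].
      destruct (hom (inv (P g i) ** P h i)) as [c1 [c2 c3]].
      destruct (hom (inv (P g (S i)) ** P h (S i))) as [d1 [d2 d3]].
      assert (t1 := Pstep g i ltac:(lia)); assert (t2 := Pstep h i ltac:(lia)).
      assert (t3 := Pthin g h i ltac:(lia)); assert (t4 := Pthin g h (S i) ltac:(lia)).
      unfold dn in t1, t2, t3, t4.
      apply ev_eq_short; auto using letters_app.
      + rewrite !length_app; lia.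
      + rewrite !ev_app, a3, b3, c3, d3; grp. }
  assert (htail : forall g i, (i <= wlen M g <= S i)%nat -> exists u, letters Q u /\ (length u <= 1)%nat /\
    ev eps u = inv (P g i) ** g /\ phi g (wlen M g) = phi g i ** ev eps' u).
  { intros g i hi; destruct (Nat.eq_dec (wlen M g) i) as [e|e].
    - exists nil; split; [apply letters_nil | split; [simpl; lia|]].
      rewrite <- e, P1; unfold ev; simpl; split; grp.
    - assert (e' : wlen M g = S i) by lia.
      destruct (hom (inv (P g i) ** P g (S i))) as [a1 [a2 a3]].
      exists (om (inv (P g i) ** P g (S i))); split; [auto | split].
      + rewrite a2; apply Pstep; lia.
      + rewrite a3, e'; rewrite <- e' at 1; rewrite P1; split; reflexivity. }
  assert (hstep : forall g l, (l <= Q)%nat ->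
    phi (g ** eps l) (wlen M (g ** eps l)) = phi g (wlen M g) ** eps' l).
  { intros g l hlQ; set (h := g ** eps l).
    assert (hd : (dn g h <= 1)%nat).
    { unfold dn, h; rewrite mulKl; destruct hl as [l1 [_ l3]].
      destruct (Nat.eq_dec l Q) as [->|hne]; [rewrite l3, wlen_one; lia|].
      apply wlen_gen, l1; lia. }
    assert (t1 := dn_tri one g h); assert (t2 := dn_tri one h g).
    rewrite (dn_sym h g), !dn_1 in *.
    assert (h0 : wlen M g = 0%nat -> wlen M h = 0%nat -> dn g h = 0%nat).
    { intros a b; apply wlen_0 in a, b; rewrite a, b; apply dn_refl. }
    (* The last time at which thinness applies is at most one step before either end. [h0] excludes
       the case of two lengths [0] and [dn g h = 1], where the truncated subtraction would fail. *)
    assert (hi : exists i, (i <= wlen M g <= S i)%nat /\ (i <= wlen M h <= S i)%nat /\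
              (2 * i + dn g h <= wlen M g + wlen M h)%nat).
    { destruct (Nat.eq_dec (dn g h) 0) as [e|e]; [exists (wlen M g); lia|].
      exists ((wlen M g + wlen M h - 1) / 2)%nat.
      assert (hdiv := Nat.div_mod_eq (wlen M g + wlen M h - 1) 2).
      assert (hmod := Nat.mod_upper_bound (wlen M g + wlen M h - 1) 2); lia. }
    destruct hi as [i [hg [hh hgh]]].
    destruct (htail g i hg) as [u [u1 [u2 [u3 u4]]]].
    destruct (htail h i hh) as [v [v1 [v2 [v3 v4]]]].
    rewrite u4, v4, <- (hladder g h i) by lia.
    destruct (hom (inv (P g i) ** P h i)) as [c1 [c2 c3]].
    assert (t3 := Pthin g h i hgh); unfold dn in t3.
    replace (eps' l) with (ev eps' (l :: nil)) by (unfold ev; simpl; grp).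
    rewrite !mulA, <- !ev_app; f_equal.
    apply ev_eq_short; auto using letters_app, letters_cons, letters_nil.
    - rewrite !length_app; simpl; lia.
    - rewrite !ev_app, u3, v3, c3, ev_cons; unfold ev, h; simpl; grp. }
  assert (hphi : forall w, letters Q w -> phi (ev eps w) (wlen M (ev eps w)) = ev eps' w).
  { clear w; induction w as [|l w IH] using rev_ind; intros hw.
    - unfold ev; simpl; rewrite wlen_one; reflexivity.
    - rewrite !ev_app; replace (ev eps (l :: nil)) with (eps l) by (unfold ev; simpl; grp).
      rewrite hstep, IH.
      + f_equal; unfold ev; simpl; grp.
      + intros i hi; apply hw, in_or_app; auto.
      + apply hw, in_or_app; right; now left. }
  intros hw e; rewrite <- (hphi w hw), e, wlen_one; reflexivity.
Qed.

Lemma ev_eq_transfer (thin : thin_geodesics M d) (u v : list nat) :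
  letters Q u -> letters Q v -> ev eps u = ev eps v -> ev eps' u = ev eps' v.
Proof.
  intros hu hv e; destruct (inverse_word_exists v hv) as [v' [h1 [h2 [h3 h4]]]].
  apply (mulIr (inv (ev eps' v))); rewrite mulVr, <- h4, <- ev_app.
  apply (relation_transfer thin); [now apply letters_app|].
  rewrite ev_app, h3, e; grp.
Qed.

End Presentation.

(** Transferring relations in both directions makes the image of an element independent of the word
    that spells it, and makes the map injective. *)
Lemma marked_iso_of_short_relations (M M' : MarkedGroup) (Q d : nat)
  (eps : nat -> mg_carrier M) (eps' : nat -> mg_carrier M') :
  labelling M Q eps -> labelling M' Q eps' -> thin_geodesics M d -> thin_geodesics M' d ->
  (forall w, letters Q w -> length w = (2 * d + 4)%nat -> (ev eps w = one <-> ev eps' w = one)) ->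
  marked_iso M M'.
Proof.
  intros hl hl' th th' heq.
  assert (heq' : forall w, letters Q w -> (length w <= 2 * d + 4)%nat ->
            (ev eps w = one <-> ev eps' w = one)).
  { intros w hw hlen; set (p := repeat Q (2 * d + 4 - length w)).
    assert (hp : letters Q (w ++ p)).
    { apply letters_app; auto; intros i hi; apply repeat_spec in hi; lia. }
    assert (t := heq (w ++ p) hp); rewrite !ev_app in t; unfold p in t.
    rewrite !ev_repeat_one, !mul1r, length_app, repeat_length in t; [apply t; lia | apply hl' | apply hl]. }
  assert (tr : forall u v, letters Q u -> letters Q v -> ev eps u = ev eps v -> ev eps' u = ev eps' v).
  { intros u v; apply (ev_eq_transfer (d := d) eps eps' hl); auto; intros w h1 h2; now apply heq'. }
  assert (tr' : forall u v, letters Q u -> letters Q v -> ev eps' u = ev eps' v -> ev eps u = ev eps v).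
  { intros u v; apply (ev_eq_transfer (d := d) eps' eps hl'); auto; intros w h1 h2; now apply heq'. }
  set (om := fun g => proj1_sig (constructive_indefinite_description _ (word_exists eps hl g))).
  assert (hom : forall g, letters Q (om g) /\ ev eps (om g) = g).
  { intros g; unfold om; destruct constructive_indefinite_description as [w hw]; simpl; tauto. }
  assert (hf : forall w, letters Q w -> ev eps' (om (ev eps w)) = ev eps' w).
  { intros w hw; apply tr; auto; apply hom. }
  assert (h1 : forall (N : MarkedGroup) (f : nat -> mg_carrier N) i, ev f (i :: nil) = f i)
    by (intros; unfold ev; simpl; grp).
  exists (fun g => ev eps' (om g)); split; [|split; [|split; [|split]]].
  - intros x y; rewrite <- ev_app; apply tr; [apply hom | apply letters_app; apply hom |].
    rewrite ev_app, !(fun g => proj2 (hom g)); reflexivity.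
  - intros x y e; apply tr' in e; try apply hom.
    now rewrite !(fun g => proj2 (hom g)) in e.
  - intros z; destruct (word_exists eps' hl' z) as [w [hw [_ e]]].
    exists (ev eps w); now rewrite hf.
  - intros s hs; destruct (proj1 (proj2 hl) s hs) as [i [hi <-]].
    rewrite <- (h1 _ eps), hf, h1; [apply hl'; auto|].
    apply letters_cons, letters_nil; lia.
  - intros s hs; destruct (proj1 (proj2 hl') s hs) as [i [hi <-]].
    exists (eps i); split; [apply hl; auto|].
    rewrite <- (h1 _ eps), hf, h1; [reflexivity|].
    apply letters_cons, letters_nil; lia.
Qed.

(** * Labellings and the count of marked groups *)

Lemma labelling_exists (M : MarkedGroup) (Q : nat) (s0 : mg_carrier M) :
  In s0 (mg_gens M) -> (@bsize M 1 <= Q)%nat -> exists eps, labelling M Q eps.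
Proof.
  intros hs hQ; set (l := nodup eq_dec_cl (mg_gens M)).
  assert (hlen : (length l <= Q)%nat).
  { eapply Nat.le_trans; [apply (bsize_ge l 1) | exact hQ]; [apply NoDup_nodup|].
    intros g hg; apply nodup_In in hg; now apply wlen_gen. }
  (* The default [s0] of [nth] labels the surplus indices when there are fewer than [Q] distinct
     generators. *)
  exists (fun i => if lt_dec i Q then nth i l s0 else one); split; [|split].
  - intros i hi; destruct lt_dec; [|lia].
    destruct (Nat.lt_ge_cases i (length l)) as [h|h].
    + apply (nodup_In eq_dec_cl), nth_In; auto.
    + now rewrite nth_overflow.
  - intros s h; apply (nodup_In eq_dec_cl), (In_nth _ _ s0) in h.
    destruct h as [i [hi e]]; exists i; fold l in hi; split; [lia|].
    destruct lt_dec; [exact e | lia].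
  - destruct lt_dec; [lia | reflexivity].
Qed.

(** Equal codes yield an isomorphism whichever labellings were chosen, so one arbitrary labelling
    per group suffices and nothing is counted up to relabelling. *)
Lemma count_by_short_relations (Q d n : nat) (F : nat -> MarkedGroup) :
  (forall i, (i < n)%nat -> thin_geodesics (F i) d /\ exists eps, labelling (F i) Q eps) ->
  (forall i j, (i < n)%nat -> (j < n)%nat -> i <> j -> ~ marked_iso (F i) (F j)) ->
  (n <= 2 ^ ((Q + 1) ^ (2 * d + 4)))%nat.
Proof.
  intros hF hd.
  set (eps := fun i => epsilon (inhabits (fun _ : nat => mg_one)) (labelling (F i) Q)).
  assert (heps : forall i, (i < n)%nat -> labelling (F i) Q (eps i)).
  { intros i hi; apply epsilon_spec, hF, hi. }
  set (words := lists_of_length (seq 0 (Q + 1)) (2 * d + 4)).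
  set (code := fun i => map (fun w => if eq_dec_cl (ev (eps i) w) one then true else false) words).
  assert (nd : NoDup (map code (seq 0 n))).
  { apply NoDup_map_inj; [|apply seq_NoDup]; intros i j hi hj e.
    apply in_seq in hi, hj; apply NNPP; intros hij; apply (hd i j); try lia.
    apply (marked_iso_of_short_relations _ _ Q d (eps i) (eps j)); try (apply heps; lia);
      try (apply hF; lia).
    intros w hw hlen.
    assert (hin : In w words).
    { apply In_lists_of_length; auto; intros x hx; apply in_seq; specialize (hw x hx); lia. }
    assert (ew := proj1 map_ext_in_iff e w hin); simpl in ew.
    revert ew; repeat destruct eq_dec_cl; intros ew; try discriminate; tauto. }
  apply (NoDup_incl_length (l' := lists_of_length (true :: false :: nil) (length words))) in nd.
  - rewrite length_map, length_seq, length_lists_of_length in nd; unfold words in nd.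
    rewrite length_lists_of_length, length_seq in nd; exact nd.
  - intros c hc; apply in_map_iff in hc; destruct hc as [i [<- _]].
    apply In_lists_of_length; [|unfold code; now rewrite length_map].
    intros [|] _; simpl; auto.
Qed.

Lemma not_cyclic_nontrivial_gen (M : MarkedGroup) : ~ cyclic M ->
  exists s, In s (mg_gens M) /\ s <> (one : mg_carrier M).
Proof.
  intros nc; apply NNPP; intros hn; apply nc; exists one; intros h; exists 0%nat; left.
  change (gpow one 0) with (one : mg_carrier M).
  destruct (mg_gens_gen M h) as [w [hw <-]].
  induction w as [|s w IH]; [reflexivity|]; simpl.
  rewrite IH by (intros; apply hw; now right).
  assert (e : s = one) by (apply NNPP; intros e; apply hn; exists s; split; [apply hw; now left | auto]).
  rewrite e; grp.
Qed.

Lemma hyperbolic_discretization (M : MarkedGroup) (delta : R) (d e : nat) :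
  ~ cyclic M -> hyperbolic_marked M delta -> delta < INR d + 1 -> 2 * delta < INR e + 1 ->
  four_pt M e /\ thin_geodesics M d.
Proof.
  intros nc hyp hd he; destruct (not_cyclic_nontrivial_gen M nc) as [s0 [hs ns]]; split.
  - intros g h k; assert (t := four_point s0 hs ns hyp g h k).
    set (a := (wlen M h + dn g k)%nat); set (b := (wlen M g + dn k h)%nat).
    rewrite <- !plus_INR in t; fold a b in t.
    assert (tm : Rmax (INR a) (INR b) = INR (Nat.max a b)).
    { unfold Rmax; destruct Rle_dec as [h1|h1].
      - apply INR_le in h1; now rewrite Nat.max_r.
      - apply Rnot_le_lt, INR_lt in h1; rewrite Nat.max_l by lia; reflexivity. }
    rewrite tm in t.
    assert (t' : INR (dn g h + wlen M k) < INR (Nat.max a b + e + 1)).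
    { rewrite !(plus_INR (_ + e)), (plus_INR _ e); simpl (INR 1); lra. }
    apply INR_lt in t'; lia.
  - destruct (vertex_geodesics s0 hs ns hyp) as [P [h0 [h1 [h2 h3]]]].
    exists P; split; [auto | split; [auto | split; [auto|]]].
    intros g h i hi; specialize (h3 g h i hi).
    assert (t : INR (dn (P g i) (P h i)) < INR (d + 1)) by (rewrite plus_INR; simpl (INR 1); lra).
    apply INR_lt in t; lia.
Qed.

Theorem mainTheorem8 (nu : R -> nat)
  (nu_mono : forall x y : R, 1 <= x -> x <= y -> (nu x <= nu y)%nat)
  (nu_BGT : BGT_property nu)
  (delta H : R) (hdelta : 0 < delta) (hH : 0 < H)
  (n : nat) (F : nat -> MarkedGroup)
  (hF : forall i, (i < n)%nat ->
     torsion_free (F i) /\ ~ cyclic (F i) /\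
     hyperbolic_marked (F i) delta /\ Ent_le (F i) H)
  (hdistinct : forall i j, (i < n)%nat -> (j < n)%nat -> i <> j ->
     ~ marked_iso (F i) (F j)) :
  INR n <= N1bound nu delta H.
Proof.
  set (f := fun i => Rpower 2 (term_exp delta i)).
  assert (hpos : forall i, 0 <= f i) by (intros i; left; apply exp_pos).
  unfold N1bound; fold f.
  (* The case [n = 0] is separate because [1 <= V] is read off from a ball of [F 0]. *)
  destruct (Nat.eq_dec n 0) as [->|hn]; [simpl; now apply cond_pos_sum|].
  eapply Rle_trans; [|now apply sum_f_R0_ge_last].
  destruct (nat_floor delta ltac:(lra)) as [d hd].
  destruct (nat_floor (2 * delta) ltac:(lra)) as [e he].
  set (K1 := 3 ^ 5 * exp (72 * H * (1 + delta))).
  assert (hK1 : 1 <= K1).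
  { unfold K1; assert (t : exp 0 <= exp (72 * H * (1 + delta))); [|rewrite exp_0 in t; lra].
    apply exp_le_exp; apply Rmult_le_pos; lra. }
  set (K2 := 3 ^ 5 * exp (73 * H * (1 + 4 * delta))).
  assert (hK2 : K1 <= K2).
  { unfold K1, K2; apply Rmult_le_compat_l; [lra|]; apply exp_le_exp.
    apply Rmult_le_compat; lra || nra. }
  set (V := nu K1).
  assert (hsize : forall i, (i < n)%nat -> (@bsize (F i) 1 <= V * V)%nat /\ thin_geodesics (F i) d).
  { intros i hi; destruct (hF i hi) as [tf [nc [hyp hE]]].
    destruct (hyperbolic_discretization (F i) delta d e nc hyp) as [h4 th]; [lra | lra |].
    split; auto.
    apply (bsize_1_le nu nu_BGT (F i) e (9 * e + 21) K1); auto; [lia|].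
    now apply (doubling (F i) delta H e). }
  assert (hV : (1 <= V)%nat).
  { destruct (hsize 0%nat) as [h _]; [lia|]; assert (t := @bsize_pos (F 0%nat) 1); nia. }
  assert (hcount : (n <= 2 ^ ((V * V + 1) ^ (2 * d + 4)))%nat).
  { apply (count_by_short_relations (V * V) d n F); auto.
    intros i hi; destruct (hsize i hi) as [h1 h2]; split; auto.
    destruct (not_cyclic_nontrivial_gen (F i)) as [s [hs _]]; [apply hF; auto|].
    now apply (labelling_exists _ _ s). }
  set (N := Z.to_nat (Int_part (Defs.Nbound nu delta H 1))).
  assert (hVR : 1 <= INR V) by (apply le_INR in hV; exact hV).
  assert (hN : INR (V * V + 1) <= 2 * INR N /\ (1 <= N)%nat).
  { assert (hb : 4 * (INR V * INR V) + 9 * INR V <= Defs.Nbound nu delta H 1).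
    { unfold Defs.Nbound; fold K1 K2 V.
      assert (hc : 4 <= 20 * (1 + delta) / (5 * 1 + delta)).
      { apply (Rmult_le_reg_r (5 * 1 + delta)); [lra|].
        unfold Rdiv; rewrite Rmult_assoc, Rinv_l by lra; lra. }
      assert (hv2 : INR V <= INR (nu K2)) by (apply le_INR, nu_mono; auto).
      replace (4 * (INR V * INR V) + 9 * INR V) with (INR V * (1 + 4 * (INR V + 2))) by ring.
      apply Rmult_le_compat_l; [lra|]; apply Rplus_le_compat_l.
      apply Rmult_le_compat; lra. }
    destruct (base_Int_part (Defs.Nbound nu delta H 1)) as [i1 i2].
    assert (hi : (1 <= Int_part (Defs.Nbound nu delta H 1))%Z).
    { apply le_IZR; nra. }
    assert (hNR : INR N = IZR (Int_part (Defs.Nbound nu delta H 1))).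
    { unfold N; rewrite INR_IZR_INZ, Z2Nat.id by lia; reflexivity. }
    split; [|unfold N; lia].
    rewrite plus_INR, mult_INR, hNR; simpl (INR 1); nra. }
  destruct hN as [hN1 hN2].
  apply le_INR in hcount; eapply Rle_trans; [exact hcount|].
  rewrite Rpower_INR by lia; unfold f; simpl (INR 2).
  apply Rle_Rpower; [lra|].
  rewrite Rpower_INR by lia.
  unfold term_exp; destruct N as [|N']; [lia|].
  set (b := INR (V * V + 1)) in *.
  assert (hb1 : 1 < b).
  { unfold b; rewrite plus_INR, mult_INR; simpl (INR 1); nra. }
  (* The exponent is raised from [2 * d + 4 <= 2 * delta + 4] to [4 * delta + 6], then the base from
     [V * V + 1] to twice the last index. *)
  apply Rle_trans with (Rpower b (4 * delta + 6)).
  - apply Rle_Rpower; [lra|]; rewrite plus_INR, mult_INR; simpl (INR 2); simpl (INR 4); lra.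
  - apply Rle_Rpower_l; lra.
Qed.
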